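(* Let $n\ge 1$ be an integer, $p>2$, $\alpha>0$, and $\varphi(v)=v|v|^{p-2}$. Assume that $f:\mathbb{R}\to\mathbb{R}$ is Lipschitz continuous and $f(\alpha)>0$. Then for $\epsilon>0$ sufficiently small, the problem $$\frac{d}{dr}\varphi(U'(r))+\frac{n-1}{r}\,\varphi(U'(r))+f(U(r))=0,\qquad U(0)=\alpha,\ U'(0)=0,$$ has a solution of the form $U(r)=u\big(r^{\frac{p}{2(p-1)}}\big)$ for $0\le r<\epsilon^{\frac{2(p-1)}{p}}$, where $u=u(z)\in C^2[0,\epsilon)$ and $u'(z)<0$ on $(0,\epsilon)$. This solution is unique among all continuous functions $U$ on $[0,\epsilon^{\frac{2(p-1)}{p}})$ satisfying the integral equation $$U(r)=\alpha-\int_0^r \frac{1}{t^{\frac{n-1}{p-1}}}\left[\int_0^t s^{n-1} f(U(s))\,ds\right]^{\frac{1}{p-1}}dt .$$ If, moreover, $f\in C^k$ (for an integer $k\ge 1$), then $u(z)\in C^{k+2}[0,\epsilon)$.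
   Context: A solution of the initial value problem on $[0,R)$ is a function $U\in C^1[0,R)$ such that $\varphi(U')$ is continuously differentiable on $(0,R)$, the equation holds for all $r\in(0,R)$, and the initial conditions hold. Functions in $C^m[0,\epsilon)$ have one-sided derivatives up to order $m$ at $0$, continuous on $[0,\epsilon)$. A function satisfies the integral equation only if the inner integral $\int_0^t s^{n-1}f(U(s))\,ds$ is nonnegative for all $t$ in the interval (so that the power $\frac1{p-1}$ is defined). *)

(* Defs.v *)
From Stdlib Require Import Reals Lra.
From Coquelicot Require Import Coquelicot.
Open Scope R_scope.

(* x^a for x >= 0.  Stdlib's Rpower is meant for x > 0 only: it takes the
   value 1 at x = 0 for every exponent, so 0 is treated separately. *)
Definition rpow (x a : R) : R :=
  if Req_EM_T x 0 then (if Req_EM_T a 0 then 1 else 0) else Rpower x a.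

Definition phi (p v : R) : R := v * rpow (Rabs v) (p - 2).

Definition lipschitz (f : R -> R) : Prop :=
  exists L : R, forall x y : R, Rabs (f x - f y) <= L * Rabs (x - y).

Definition of_class_C (k : nat) (f : R -> R) : Prop :=
  (forall (j : nat) (x : R), (j <= k)%nat -> ex_derive_n f j x) /\
  (forall x : R, continuous (Derive_n f k) x).

Definition Ico (b x : R) : Prop := 0 <= x < b.

(* Functions on [0, b) are total functions whose values outside [0, b) are
   ignored; the derivative at 0 is one-sided. *)
Definition derive_on_Ico (b : R) (g dg : R -> R) : Prop :=
  forall x : R, Ico b x ->
    filterlim (fun y => (g y - g x) / (y - x))
              (within (Ico b) (locally' x)) (locally (dg x)).

Fixpoint of_class_C_Ico (m : nat) (b : R) (g : R -> R) : Prop :=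
  match m with
  | O => continuous_on (Ico b) g
  | S m' => continuous_on (Ico b) g /\
      exists dg : R -> R, derive_on_Ico b g dg /\ of_class_C_Ico m' b dg
  end.

Definition ivp_solution (n : nat) (p alpha : R) (f : R -> R) (b : R)
    (U : R -> R) : Prop :=
  exists dU : R -> R,
    derive_on_Ico b U dU /\ continuous_on (Ico b) dU /\
    (forall r : R, 0 < r < b ->
       ex_derive (fun t => phi p (dU t)) r /\
       continuous (Derive (fun t => phi p (dU t))) r /\
       Derive (fun t => phi p (dU t)) r
         + (INR n - 1) / r * phi p (dU r) + f (U r) = 0) /\
    U 0 = alpha /\ dU 0 = 0.

Definition inner_integral (n : nat) (f U : R -> R) (t : R) : R :=
  RInt (fun s => s ^ (n - 1) * f (U s)) 0 t.

(* When f is continuous and U is continuous on [0, b), the inner integral exists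
   and is O(t^n), so the outer integrand is bounded and continuous on (0, r]:
   both Riemann integrals exist, and the outer one does not depend on the value
   of its integrand at t = 0. *)
Definition integral_equation (n : nat) (p alpha : R) (f : R -> R) (b : R)
    (U : R -> R) : Prop :=
  (forall t : R, Ico b t -> 0 <= inner_integral n f U t) /\
  (forall r : R, Ico b r ->
     U r = alpha -
       RInt (fun t => 1 / rpow t ((INR n - 1) / (p - 1))
                      * rpow (inner_integral n f U t) (1 / (p - 1))) 0 r).

(* Main.v *)
Require Import Defs.
From Stdlib Require Import Reals Lra Lia Psatz.
From Coquelicot Require Import Coquelicot.
Open Scope R_scope.

(* Put q = 1/(p-1), beta = 2(p-1)/p, so that beta (1+q) = 2. Scaling the inner integral gives
   int_0^t s^(n-1) f(U(s)) ds = t^n J(t) with J(t) = int_0^1 s^(n-1) f(U(ts)) ds, and the integral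
   equation becomes U(r) = alpha - int_0^r t^q J(t)^q dt. Near r = 0 the quantity J stays close to
   f(alpha)/n > 0, where x^q is Lipschitz, so for f truncated to [f(alpha)/2, 2 f(alpha)] this is
   a contraction. Any solution V of the original equation is nonincreasing, hence alpha - V(r)
   is bounded by r times an affine function of itself; so V stays near alpha, the truncation is
   invisible, and uniqueness follows.
   With u(z) = U(|z|^beta) and H(z) = J(|z|^beta) one has u' = - beta z H^q. The identity
   z H' = beta (f(u) - n H) then gives
   u'' = - beta H^q - beta q H^(q-1) beta (f(u) - n H),
   which involves no derivative of f and no division by z; and H is a weighted average of
   f(u) over the segment [0, z], so u'' is as smooth as f(u), and u gains regularity
   up to C^(k+2) by induction. Everything is even in z, so all derivatives at 0 are two-sided. *)

(** * Powers of the absolute value *)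

(** The exponent comes first so that [apow a] is a function to compose and differentiate. The
    absolute value makes it even, so that derivatives taken at 0 are two-sided. *)
Definition apow (a x : R) : R := rpow (Rabs x) a.

Lemma rpow_pos (x a : R) : 0 < x -> rpow x a = Rpower x a.
Proof. intros Hx; unfold rpow; destruct (Req_EM_T x 0); [lra | easy]. Qed.

Lemma apow_neq0 (a x : R) : x <> 0 -> apow a x = Rpower (Rabs x) a.
Proof. intros Hx; apply rpow_pos, Rabs_pos_lt, Hx. Qed.

Lemma apow_nonneg (a x : R) : 0 <= x -> apow a x = rpow x a.
Proof. intros Hx; unfold apow; now rewrite Rabs_pos_eq. Qed.

Lemma apow_pos (a x : R) : 0 < x -> apow a x = Rpower x a.
Proof. intros Hx; rewrite apow_nonneg by lra; now apply rpow_pos. Qed.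

Lemma apow_at0 (a : R) : a <> 0 -> apow a 0 = 0.
Proof.
  intros Ha; unfold apow, rpow; rewrite Rabs_R0.
  destruct (Req_EM_T 0 0); [| lra]; destruct (Req_EM_T a 0); lra.
Qed.

Lemma apow_gt0 (a x : R) : x <> 0 -> 0 < apow a x.
Proof. intros Hx; rewrite apow_neq0 by easy; apply exp_pos. Qed.

Lemma apow_ge0 (a x : R) : 0 <= apow a x.
Proof.
  destruct (Req_dec x 0) as [-> | Hx]; [| now left; apply apow_gt0].
  unfold apow, rpow; rewrite Rabs_R0.
  destruct (Req_EM_T 0 0); [| lra]; destruct (Req_EM_T a 0); lra.
Qed.

Lemma apow_abs (a x : R) : apow a (Rabs x) = apow a x.
Proof. unfold apow; now rewrite Rabs_Rabsolu. Qed.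

Lemma apow_1 (x : R) : apow 1 x = Rabs x.
Proof.
  destruct (Req_dec x 0) as [-> | Hx].
  - rewrite apow_at0, Rabs_R0; lra.
  - rewrite apow_neq0 by easy; now apply Rpower_1, Rabs_pos_lt.
Qed.

Lemma apow_plus (a b x : R) : x <> 0 -> apow (a + b) x = apow a x * apow b x.
Proof. intros Hx; rewrite !apow_neq0 by easy; apply Rpower_plus. Qed.

Lemma apow_apow (a b x : R) : a <> 0 -> b <> 0 -> apow a (apow b x) = apow (a * b) x.
Proof.
  intros Ha Hb; destruct (Req_dec x 0) as [-> | Hx].
  - rewrite !apow_at0; auto; now apply Rmult_integral_contrapositive.
  - rewrite (apow_pos a) by now apply apow_gt0.
    rewrite !apow_neq0 by easy; rewrite Rpower_mult; f_equal; ring.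
Qed.

Lemma apow_mult (a x y : R) : a <> 0 -> apow a (x * y) = apow a x * apow a y.
Proof.
  intros Ha.
  destruct (Req_dec x 0) as [-> | Hx]; [rewrite Rmult_0_l, apow_at0; lra |].
  destruct (Req_dec y 0) as [-> | Hy]; [rewrite Rmult_0_r, apow_at0; lra |].
  rewrite !apow_neq0 by (try apply Rmult_integral_contrapositive; auto).
  rewrite Rabs_mult; symmetry; apply Rpower_mult_distr; now apply Rabs_pos_lt.
Qed.

Lemma apow_le1 (a x : R) : 0 < a -> Rabs x <= 1 -> apow a x <= 1.
Proof.
  intros Ha Hx; destruct (Req_dec x 0) as [-> | Hx0]; [rewrite apow_at0; lra |].
  rewrite apow_neq0 by easy.
  apply Rle_trans with (Rpower 1 a); [| unfold Rpower; rewrite ln_1, Rmult_0_r, exp_0; lra].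
  apply Rle_Rpower_l; [lra | split; [now apply Rabs_pos_lt | easy]].
Qed.

(** Split at x = 1. The linear bound makes estimates of the slope affine: it gives the constant
    [1 + M] of the iteration, and an inequality that can be solved for alpha - V(r) in the a priori
    bound. *)
Lemma apow_le_1p (a x : R) : 0 < a <= 1 -> 0 <= x -> apow a x <= 1 + x.
Proof.
  intros Ha Hx; destruct (Rle_dec x 1) as [H1 | H1].
  - assert (apow a x <= 1) by (apply apow_le1; [lra | rewrite Rabs_pos_eq; lra]); lra.
  - rewrite apow_pos by lra.
    assert (Rpower x a <= Rpower x 1) by (apply Rle_Rpower; lra).
    rewrite Rpower_1 in H; lra.
Qed.

Lemma apow_le_base (a x : R) : 1 <= a -> 0 < x <= 1 -> apow a x <= x.
Proof.
  intros Ha Hx.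
  replace a with ((a - 1) + 1) by ring.
  rewrite apow_plus, apow_1, (Rabs_pos_eq x) by lra.
  destruct (Req_dec a 1) as [-> | Ha1].
  - rewrite apow_pos by lra; replace (1 - 1) with 0 by ring; rewrite Rpower_O; lra.
  - assert (apow (a - 1) x <= 1) by (apply apow_le1; [lra | rewrite Rabs_pos_eq; lra]).
    nra.
Qed.

Lemma apow_lt (a x y : R) : 0 < a -> 0 <= x < y -> apow a x < apow a y.
Proof.
  intros Ha [[Hx | <-] Hy].
  - rewrite !apow_pos by lra; now apply Rlt_Rpower_l; [| split].
  - rewrite apow_at0 by lra; apply apow_gt0; lra.
Qed.

Lemma is_derive_apow_pos (a x : R) :
  0 < x -> is_derive (apow a) x (a * apow (a - 1) x).
Proof.
  intros Hx; rewrite (apow_pos (a - 1)) by easy.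
  apply is_derive_ext_loc with (fun t => Rpower t a).
  - apply (locally_interval _ x 0 p_infty); simpl; auto.
    intros y Hy _; now rewrite apow_pos.
  - apply is_derive_Reals, derivable_pt_lim_power, Hx.
Qed.

Lemma continuous_apow (a x : R) : 0 < a -> continuous (apow a) x.
Proof.
  intros Ha.
  assert (Hpos : forall y, 0 < y -> continuous (apow a) y).
  { intros y Hy; apply (ex_derive_continuous (apow a) y); eexists.
    now apply is_derive_apow_pos. }
  apply continuous_ext with (fun y => apow a (Rabs y)); [apply apow_abs |].
  destruct (Req_dec x 0) as [-> | Hx].
  - apply (continuous_ext (apow a)); [intro; symmetry; apply apow_abs |].
    apply continuity_pt_filterlim; intros e He.
    exists (Rpower e (/ a)); split; [apply exp_pos |].
    intros y [_ Hy]; simpl in *; unfold R_dist in *.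
    rewrite (apow_at0 a), Rminus_0_r, Rabs_pos_eq by (apply apow_ge0 || lra).
    rewrite Rminus_0_r in Hy; rewrite <- apow_abs.
    apply Rlt_le_trans with (apow a (Rpower e (/ a))).
    + apply apow_lt; [lra | split; [apply Rabs_pos | easy]].
    + rewrite apow_pos by apply exp_pos.
      rewrite Rpower_mult, Rinv_l, Rpower_1; lra.
  - apply (continuous_comp Rabs (apow a)); [apply continuous_Rabs |].
    now apply Hpos, Rabs_pos_lt.
Qed.

(** The factor [x * apow (a - 2) x] is odd, so one formula serves both signs, and it vanishes at 0
    whatever value [apow (a - 2) 0] takes. *)
Lemma is_derive_apow (a x : R) :
  1 < a -> is_derive (apow a) x (a * (x * apow (a - 2) x)).
Proof.
  intros Ha.
  assert (Hpos : forall y, 0 < y -> is_derive (apow a) y (a * (y * apow (a - 2) y))).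
  { intros y Hy.
    replace (y * apow (a - 2) y) with (apow (a - 1) y); [now apply is_derive_apow_pos |].
    replace (a - 1) with (1 + (a - 2)) by ring.
    rewrite apow_plus, apow_1, Rabs_pos_eq; lra. }
  destruct (Rtotal_order x 0) as [Hx | [-> | Hx]]; [| | now apply Hpos].
  - apply is_derive_ext with (fun y => apow a (- y)).
    { intro y; unfold apow; now rewrite Rabs_Ropp. }
    replace (a * (x * apow (a - 2) x)) with (scal (- 1) (a * (- x * apow (a - 2) (- x)))).
    2:{ unfold scal; simpl; unfold mult; simpl; unfold apow; rewrite Rabs_Ropp; ring. }
    apply (is_derive_comp (apow a) Ropp); [apply Hpos; lra |].
    apply (is_derive_opp (fun y : R => y)), (is_derive_id (K := R_AbsRing)).
  (* At 0 the difference quotient has absolute value |h|^(a-1), which tends to 0 because a > 1. *)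
  - replace (a * (0 * apow (a - 2) 0)) with 0 by ring.
    apply is_derive_Reals; intros e He.
    assert (Hc : continuous (apow (a - 1)) 0) by (apply continuous_apow; lra).
    apply continuity_pt_filterlim in Hc.
    destruct (Hc e He) as [d [Hd H]]; exists (mkposreal d Hd).
    intros h Hh0 Hh; simpl in *; unfold R_dist in H.
    rewrite Rplus_0_l, (apow_at0 a), !Rminus_0_r by lra.
    specialize (H h); rewrite (apow_at0 (a - 1)), !Rminus_0_r in H by lra.
    replace a with ((a - 1) + 1) by ring.
    rewrite apow_plus, apow_1 by easy.
    unfold Rdiv; rewrite !Rabs_mult, Rabs_inv, Rabs_Rabsolu.
    rewrite Rmult_assoc, Rinv_r, Rmult_1_r by now apply Rabs_no_R0.
    apply H; split; [split; [exact I | now apply not_eq_sym] | easy].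
Qed.

(** * Riemann integrals of continuous functions *)

Lemma continuous_ex_RInt (f : R -> R) (a b : R) :
  (forall x, continuous f x) -> ex_RInt f a b.
Proof. intros Hf; apply (ex_RInt_continuous (V := R_CompleteNormedModule)); auto. Qed.

Lemma is_derive_RInt_upper (f : R -> R) (a x : R) :
  (forall y, continuous f y) -> is_derive (fun y => RInt f a y) x (f x).
Proof.
  intros Hf; apply is_derive_RInt with a; [| apply Hf].
  apply filter_forall; intro y.
  apply (RInt_correct (V := R_CompleteNormedModule)); now apply continuous_ex_RInt.
Qed.

Lemma RInt_dist (f g : R -> R) (a b M : R) :
  a <= b -> ex_RInt f a b -> ex_RInt g a b ->
  (forall t, a <= t <= b -> Rabs (f t - g t) <= M) ->
  Rabs (RInt f a b - RInt g a b) <= (b - a) * M.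
Proof.
  intros Hab Hf Hg H.
  replace (RInt f a b - RInt g a b) with (RInt (fun t => minus (f t) (g t)) a b).
  - apply abs_RInt_le_const; auto.
    now apply (ex_RInt_minus (V := R_NormedModule)).
  - now apply (RInt_minus (V := R_CompleteNormedModule)).
Qed.

(** * Functions of class C^m *)

(* Derivatives are two-sided at every point of [D], so this is meant for open [D]. *)
Fixpoint smooth_on (m : nat) (D : R -> Prop) (g : R -> R) : Prop :=
  (forall x, D x -> continuous g x) /\
  match m with
  | O => True
  | S m' => exists dg : R -> R,
      (forall x, D x -> is_derive g x (dg x)) /\ smooth_on m' D dg
  end.

Lemma smooth_on_continuous m D g : smooth_on m D g -> forall x, D x -> continuous g x.
Proof. now destruct m; intros [H _]. Qed.

Lemma smooth_on_S m (D : R -> Prop) (g dg : R -> R) :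
  (forall x, D x -> is_derive g x (dg x)) -> smooth_on m D dg -> smooth_on (S m) D g.
Proof.
  intros Hd Hm; split; [| now exists dg].
  intros x Hx; apply (ex_derive_continuous g x); eexists; now apply Hd.
Qed.

Lemma smooth_on_pred m D g : smooth_on (S m) D g -> smooth_on m D g.
Proof.
  revert g; induction m as [| m IH]; intros g [Hc [dg [Hd Hm]]]; [now split |].
  apply smooth_on_S with dg; auto.
Qed.

Lemma smooth_on_le m k D g : (k <= m)%nat -> smooth_on m D g -> smooth_on k D g.
Proof. induction 1; auto; intros H1; now apply IHle, smooth_on_pred. Qed.

Lemma smooth_on_ext m (D : R -> Prop) (f g : R -> R) :
  (forall x, D x -> locally x D) -> (forall x, D x -> f x = g x) ->
  smooth_on m D f -> smooth_on m D g.
Proof.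
  intros Ho He.
  assert (Hl : forall x, D x -> locally x (fun y => f y = g y)).
  { intros x Hx; apply filter_imp with D; auto. }
  destruct m; intros [Hc Hd]; split; auto.
  1, 2: intros x Hx; apply continuous_ext_loc with f; auto.
  destruct Hd as [dg [Hd Hm]]; exists dg; split; auto.
  intros x Hx; apply is_derive_ext_loc with f; auto.
Qed.

Lemma smooth_on_const m D (c : R) : smooth_on m D (fun _ => c).
Proof.
  revert c; induction m; intro c.
  - split; [intros; apply continuous_const | easy].
  - apply smooth_on_S with (fun _ => 0); auto.
    intros; apply (is_derive_const c).
Qed.

Lemma smooth_on_plus m D (f g : R -> R) :
  smooth_on m D f -> smooth_on m D g -> smooth_on m D (fun x => f x + g x).
Proof.
  revert f g; induction m as [| m IH]; intros f g [Hf Hf'] [Hg Hg'].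
  - split; [| easy]; intros x Hx; now apply (continuous_plus f g); auto.
  - destruct Hf' as [df [Hdf Hmf]], Hg' as [dg [Hdg Hmg]].
    apply smooth_on_S with (fun x => df x + dg x); auto.
    intros x Hx; apply (is_derive_plus f g); auto.
Qed.

Lemma smooth_on_mult m D (f g : R -> R) :
  smooth_on m D f -> smooth_on m D g -> smooth_on m D (fun x => f x * g x).
Proof.
  revert f g; induction m as [| m IH]; intros f g Hf Hg.
  - destruct Hf as [Hf _], Hg as [Hg _].
    split; [| easy]; intros x Hx; now apply (continuous_mult f g); auto.
  - pose proof (smooth_on_pred _ _ _ Hf); pose proof (smooth_on_pred _ _ _ Hg).
    destruct Hf as [_ [df [Hdf Hmf]]], Hg as [_ [dg [Hdg Hmg]]].
    apply smooth_on_S with (fun x => df x * g x + f x * dg x).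
    + intros x Hx; apply (is_derive_mult f g); auto; intros; apply Rmult_comm.
    + apply smooth_on_plus; auto.
Qed.

Lemma smooth_on_comp m (D E : R -> Prop) (f g : R -> R) :
  (forall x, D x -> E (g x)) ->
  smooth_on m E f -> smooth_on m D g -> smooth_on m D (fun x => f (g x)).
Proof.
  intros HDE; revert f; induction m as [| m IH]; intros f Hf Hg.
  - destruct Hf as [Hf _], Hg as [Hg _].
    split; [| easy]; intros x Hx; now apply continuous_comp; auto.
  - pose proof (smooth_on_pred _ _ _ Hg).
    destruct Hf as [_ [df [Hdf Hmf]]], Hg as [_ [dg [Hdg Hmg]]].
    apply smooth_on_S with (fun x => dg x * df (g x)).
    + intros x Hx; apply (is_derive_comp f g); auto.
    + apply smooth_on_mult; auto.
Qed.

Lemma smooth_on_apow m (a : R) : smooth_on m (Rlt 0) (apow a).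
Proof.
  revert a; induction m as [| m IH]; intro a.
  - split; [| easy]; intros x Hx; apply (ex_derive_continuous (apow a) x).
    eexists; now apply is_derive_apow_pos.
  - apply smooth_on_S with (fun x => a * apow (a - 1) x).
    + intros; now apply is_derive_apow_pos.
    + apply smooth_on_mult; auto using smooth_on_const.
Qed.

Lemma smooth_on_of_class_C k (f : R -> R) (D : R -> Prop) :
  of_class_C k f -> smooth_on k D f.
Proof.
  intros [Hd Hc].
  enough (H : forall j i, (i + j = k)%nat -> smooth_on j D (Derive_n f i)) by now apply (H k 0%nat).
  induction j as [| j IH]; intros i Hi.
  - split; [| easy]; rewrite Nat.add_0_r in Hi; subst; auto.
  - apply smooth_on_S with (Derive_n f (S i)); [| apply IH; lia].
    intros x _; apply (Derive_correct (Derive_n f i)).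
    apply (Hd (S i)); lia.
Qed.

(** Two-sided derivatives restrict to one-sided ones. Only the values of [f] on [0, b) matter, so
    any extension [g] that is differentiable at those points will do. *)
Lemma derive_on_Ico_of_is_derive (b : R) (f g dg : R -> R) :
  (forall x, Ico b x -> f x = g x) ->
  (forall x, Ico b x -> is_derive g x (dg x)) -> derive_on_Ico b f dg.
Proof.
  intros He Hd x Hx.
  apply filterlim_within_ext with (fun y => (g y - g x) / (y - x)).
  { intros y Hy; now rewrite !He. }
  specialize (Hd x Hx); apply is_derive_Reals in Hd.
  intros P [e HP]; destruct (Hd e (cond_pos e)) as [d H]; exists d.
  intros y Hy Hyx _; apply HP.
  replace y with (x + (y - x)) at 1 by ring.
  apply H; [lra | exact Hy].
Qed.

Lemma of_class_C_Ico_of_smooth_on m (b : R) (D : R -> Prop) (g : R -> R) :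
  (forall x, Ico b x -> D x) -> smooth_on m D g -> of_class_C_Ico m b g.
Proof.
  intros HD; revert g; induction m as [| m IH]; intros g Hg.
  - apply continuous_on_forall; intros x Hx; now apply (proj1 Hg), HD.
  - split.
    + apply continuous_on_forall; intros x Hx; now apply (proj1 Hg), HD.
    + destruct Hg as [_ [dg [Hd Hm]]]; exists dg; split; auto.
      apply (derive_on_Ico_of_is_derive b g g); auto.
Qed.

(** * Weighted averages over segments *)

(** In the uses below [theta] maps [0, 1] into itself: the identity gives averages over balls in the
    variable r, and [apow (/ beta)] gives the same averages in the variable z. *)
Definition average (w theta g : R -> R) (x : R) : R :=
  RInt (fun s => w s * g (x * theta s)) 0 1.

Section Average.
Variables (w theta : R -> R).
Hypothesis w_cont : forall s, continuous w s.
Hypothesis theta_cont : forall s, continuous theta s.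
Implicit Type g : R -> R.

Lemma continuous_average_integrand g x s :
  continuous g (x * theta s) -> continuous (fun s => w s * g (x * theta s)) s.
Proof.
  intros Hg; apply (continuous_mult w); auto.
  apply (continuous_comp (fun s => x * theta s) g); auto.
  apply (continuous_scal_r x theta); auto.
Qed.

Lemma continuity_2d_average_integrand g x s :
  continuous g (x * theta s) ->
  continuity_2d_pt (fun y s => w s * g (y * theta s)) x s.
Proof.
  intros Hg; apply continuity_2d_pt_filterlim.
  assert (H1 : continuous (fun z : R * R => theta (snd z)) (x, s)).
  { apply (continuous_comp snd theta); [apply continuous_snd | apply theta_cont]. }
  apply (continuous_mult (fun z : R * R => w (snd z)) (fun z : R * R => g (fst z * theta (snd z)))).
  - apply (continuous_comp snd w); [apply continuous_snd | apply w_cont].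
  - apply (continuous_comp (fun z : R * R => fst z * theta (snd z)) g); [| exact Hg].
    apply (continuous_mult (fun z : R * R => fst z) (fun z : R * R => theta (snd z))); auto.
    apply continuous_fst.
Qed.

Lemma ex_RInt_average g x :
  (forall s, 0 <= s <= 1 -> continuous g (x * theta s)) ->
  ex_RInt (fun s => w s * g (x * theta s)) 0 1.
Proof.
  intros Hg; apply (ex_RInt_continuous (V := R_CompleteNormedModule)).
  intros s; rewrite Rmin_left, Rmax_right by lra; intros Hs.
  apply continuous_average_integrand; auto.
Qed.

Lemma continuous_average g x :
  locally x (fun y => forall s, 0 <= s <= 1 -> continuous g (y * theta s)) ->
  continuous (average w theta g) x.
Proof.
  intros Hg; pose proof (locally_singleton _ _ Hg) as Hgx; cbv beta in Hgx.
  apply filterlim_locally; intros e.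
  assert (He : 0 < e / 2) by (destruct e; simpl; lra).
  (* Uniformity in s over the compact [0, 1] bounds the difference of the integrands by [e / 2]; the
     half makes up for the non-strict integral bound. *)
  destruct (uniform_continuity_2d_1d' (fun y s => w s * g (y * theta s)) 0 1 x) with
    (eps := mkposreal _ He) as [d Hd].
  { intros s Hs; apply continuity_2d_average_integrand; auto. }
  assert (Hx : locally x (fun y => Rabs (y - x) < d)) by (exists d; intros y Hy; exact Hy).
  generalize (filter_and _ _ Hg Hx); apply filter_imp.
  intros y [Hgy Hyx]; unfold ball; simpl; unfold AbsRing_ball, abs, minus, plus, opp; simpl.
  apply Rle_lt_trans with ((1 - 0) * (e / 2)); [| destruct e; simpl in *; lra].
  apply RInt_dist; [lra | now apply ex_RInt_average | now apply ex_RInt_average |].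
  intros s Hs; left; apply Rabs_def2 in Hyx.
  apply (Hd s x s y); auto; try lra.
  replace (s - s) with 0 by ring; rewrite Rabs_R0; apply cond_pos.
Qed.

End Average.

Lemma locally_Rabs_lt (d y : R) : Rabs y < d -> locally y (fun z => Rabs z < d).
Proof.
  intros Hy; assert (Hp : 0 < d - Rabs y) by lra; exists (mkposreal _ Hp).
  intros z Hz; change (Rabs (z - y) < d - Rabs y) in Hz.
  replace z with ((z - y) + y) by ring; pose proof (Rabs_triang (z - y) y); lra.
Qed.

(** Differentiation under the integral sign. The chain rule brings out the factor [theta s], which
    joins the weight, so the derivative is again an average; this is why [smooth_on_average] inducts
    over all weights at once. *)
Lemma is_derive_average (w theta g dg : R -> R) (d : R) (x : R) :
  (forall s, continuous w s) -> (forall s, continuous theta s) ->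
  (forall s, 0 <= s <= 1 -> 0 <= theta s <= 1) ->
  (forall y, Rabs y < d -> is_derive g y (dg y)) ->
  (forall y, Rabs y < d -> continuous dg y) -> Rabs x < d ->
  is_derive (average w theta g) x (average (fun s => w s * theta s) theta dg x).
Proof.
  intros Hw Ht Ht01 Hg Hdg Hx.
  assert (Hin : forall y s, Rabs y < d -> 0 <= s <= 1 -> Rabs (y * theta s) < d).
  { intros y s Hy Hs; rewrite Rabs_mult, (Rabs_pos_eq (theta s)) by now apply Ht01.
    pose proof (Ht01 s Hs); pose proof (Rabs_pos y); nra. }
  pose proof (locally_Rabs_lt d) as Hloc.
  assert (Hder : forall y s, Rabs (y * theta s) < d ->
    is_derive (fun u => w s * g (u * theta s)) y (w s * theta s * dg (y * theta s))).
  { intros y s Hy; rewrite Rmult_assoc.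
    apply (is_derive_scal (fun u => g (u * theta s)) y (w s)).
    apply (is_derive_comp g (fun u => u * theta s)); [apply Hg; auto |].
    auto_derive; [easy | ring]. }
  unfold average at 2.
  rewrite (RInt_ext _ (fun t => Derive (fun u => w t * g (u * theta t)) x)).
  2:{ rewrite Rmin_left, Rmax_right by lra; intros s Hs.
      symmetry; apply is_derive_unique; apply Hder, Hin; [easy | lra]. }
  apply (is_derive_RInt_param (fun y s => w s * g (y * theta s)) 0 1 x);
    rewrite ?Rmin_left, ?Rmax_right by lra.
  - apply filter_imp with (fun y => Rabs y < d); auto.
    intros y Hy s Hs; eexists; now apply Hder, Hin.
  - intros s Hs.
    apply continuity_2d_pt_ext_loc with (fun y s => w s * theta s * dg (y * theta s)).
    + assert (Hp : 0 < d - Rabs (x * theta s)) by (pose proof (Hin x s Hx Hs); lra).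
      (* With weight 1 and the identity as [g], this is the continuity of (y, t) -> y theta(t),
         which keeps |y theta(t)| below d near (x, s). *)
      pose proof (continuity_2d_average_integrand (fun _ => 1) theta
        (fun s => continuous_const 1 s) Ht (fun z => z) x s (continuous_id _)
        (mkposreal _ Hp)) as H.
      revert H; apply locally_2d_impl, locally_2d_forall; intros y t H; simpl in H.
      symmetry; apply is_derive_unique, Hder.
      rewrite !Rmult_1_l in H; apply Rabs_def2 in H; apply Rabs_def1;
      pose proof (Rle_abs (x * theta s)); pose proof (Rle_abs (- (x * theta s)));
      rewrite Rabs_Ropp in *; lra.
    + apply (continuity_2d_average_integrand (fun s => w s * theta s) theta); auto.
      intros t; apply (continuous_mult w theta); auto.
  - apply filter_imp with (fun y => Rabs y < d); auto.
    intros y Hy; apply ex_RInt_average; auto.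
    intros s Hs; apply (ex_derive_continuous g); eexists; apply Hg; auto.
Qed.

Lemma smooth_on_average m (d : R) (w theta g : R -> R) :
  (forall s, continuous w s) -> (forall s, continuous theta s) ->
  (forall s, 0 <= s <= 1 -> 0 <= theta s <= 1) ->
  smooth_on m (fun y => Rabs y < d) g ->
  smooth_on m (fun y => Rabs y < d) (average w theta g).
Proof.
  intros Hw Ht Ht01; revert w Hw g.
  assert (Hcont : forall w g, (forall s, continuous w s) ->
    (forall y, Rabs y < d -> continuous g y) ->
    forall x, Rabs x < d -> continuous (average w theta g) x).
  { intros w g Hw Hg x Hx; apply continuous_average; auto.
    apply filter_imp with (fun y => Rabs y < d); [| now apply locally_Rabs_lt].
    intros y Hy s Hs; apply Hg.
    rewrite Rabs_mult, (Rabs_pos_eq (theta s)) by now apply Ht01.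
    pose proof (Ht01 s Hs); pose proof (Rabs_pos y); nra. }
  induction m as [| m IH]; intros w Hw g Hg.
  - split; [| easy]; apply Hcont; auto; apply Hg.
  - pose proof Hg as [_ [dg [Hdg Hm]]].
    apply smooth_on_S with (average (fun s => w s * theta s) theta dg).
    + intros x Hx; apply is_derive_average with d; auto.
      now apply smooth_on_continuous with m.
    + apply IH; auto; intro s; apply (continuous_mult w theta); auto.
Qed.

(** * Lipschitz estimates and averages over balls *)

Lemma continuous_pow (k : nat) (x : R) : continuous (fun s => s ^ k) x.
Proof. apply (ex_derive_continuous (fun s : R => s ^ k)); auto_derive; easy. Qed.

Lemma lipschitz_continuous (C : R) (f : R -> R) :
  (forall x y, Rabs (f x - f y) <= C * Rabs (x - y)) -> forall x, continuous f x.
Proof.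
  intros H x; apply continuity_pt_filterlim; intros e He.
  assert (HC : 0 < Rabs C + 1) by (pose proof (Rabs_pos C); lra).
  exists (e / (Rabs C + 1)); split; [now apply Rdiv_lt_0_compat |].
  intros y [_ Hy]; simpl in *; unfold R_dist in *.
  apply Rle_lt_trans with (1 := H y x).
  apply Rle_lt_trans with ((Rabs C + 1) * Rabs (y - x)).
  - apply Rmult_le_compat_r; [apply Rabs_pos | pose proof (Rle_abs C); lra].
  - apply Rmult_lt_compat_l with (r := Rabs C + 1) in Hy; auto.
    field_simplify in Hy; lra.
Qed.

(** Mean value theorem: since q - 1 <= 0, the derivative q c^(q-1) for c >= a is largest at c =
    a. *)
Lemma apow_lipschitz (q a : R) : 0 < q <= 1 -> 0 < a ->
  exists K, 0 <= K /\ forall x y, a <= x -> a <= y ->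
    Rabs (apow q x - apow q y) <= K * Rabs (x - y).
Proof.
  intros Hq Ha; exists (q * apow (q - 1) a).
  assert (Hpos : forall c, 0 < c -> 0 < apow (q - 1) c) by (intros; apply apow_gt0; lra).
  split; [specialize (Hpos a Ha); nra |].
  intros x y Hx Hy.
  assert (Hmin : a <= Rmin y x) by now apply Rmin_glb.
  destruct (MVT_gen (apow q) y x (fun c => q * apow (q - 1) c)) as [c [Hc ->]].
  - intros c Hc; apply is_derive_apow_pos; lra.
  - intros c Hc; apply continuity_pt_filterlim, continuous_apow; lra.
  - rewrite Rabs_mult; apply Rmult_le_compat_r; [apply Rabs_pos |].
    rewrite Rabs_pos_eq by (specialize (Hpos c ltac:(lra)); nra).
    apply Rmult_le_compat_l; [lra |].
    rewrite !apow_pos by lra.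
    replace (q - 1) with (- (1 - q)) by ring; rewrite !Rpower_Ropp.
    apply Rinv_le_contravar; [apply exp_pos | apply Rle_Rpower_l; lra].
Qed.

(** For t > 0 this is 1/n times the mean of x -> g(|x|) over the ball of radius t in R^n. With g = f
    o U it is the J introduced at the start. *)
Definition ball_average (n : nat) : (R -> R) -> R -> R :=
  average (fun s => s ^ (n - 1)) (fun s => s).

Lemma continuous_ball_average n (g : R -> R) :
  (forall x, continuous g x) -> forall t, continuous (ball_average n g) t.
Proof.
  intros Hg t; unfold ball_average.
  refine (continuous_average (fun s => s ^ (n - 1)) (fun s => s) _ _ g t _).
  - apply continuous_pow.
  - apply continuous_id.
  - apply filter_forall; intros y s _; apply Hg.
Qed.

Lemma ex_RInt_ball_average n (g : R -> R) (t : R) :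
  (forall x, continuous g x) -> ex_RInt (fun s => s ^ (n - 1) * g (t * s)) 0 1.
Proof.
  intros Hg; apply (ex_RInt_average (fun s => s ^ (n - 1)) (fun s => s)).
  - apply continuous_pow.
  - apply continuous_id.
  - intros s _; apply Hg.
Qed.

Lemma pow_01 (k : nat) (s : R) : 0 <= s <= 1 -> 0 <= s ^ k <= 1.
Proof. intros Hs; split; [now apply pow_le | rewrite <- (pow1 k); now apply pow_incr]. Qed.

Lemma ball_average_le n (g h : R -> R) (t : R) :
  (forall x, continuous g x) -> (forall x, continuous h x) ->
  (forall s, 0 <= s <= 1 -> g (t * s) <= h (t * s)) ->
  ball_average n g t <= ball_average n h t.
Proof.
  intros Hg Hh H; apply RInt_le; try lra; try now apply ex_RInt_ball_average.
  intros s Hs; apply Rmult_le_compat_l; [apply pow_01 | apply H]; lra.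
Qed.

Lemma ball_average_dist n (g h : R -> R) (t B : R) :
  (forall x, continuous g x) -> (forall x, continuous h x) ->
  (forall s, 0 <= s <= 1 -> Rabs (g (t * s) - h (t * s)) <= B) ->
  Rabs (ball_average n g t - ball_average n h t) <= B.
Proof.
  intros Hg Hh H; replace B with ((1 - 0) * B) by ring.
  apply RInt_dist; try lra; try now apply ex_RInt_ball_average.
  intros s Hs; rewrite <- Rmult_minus_distr_l, Rabs_mult.
  pose proof (pow_01 (n - 1) s Hs); rewrite (Rabs_pos_eq (s ^ (n - 1))) by lra.
  pose proof (H s Hs); pose proof (Rabs_pos (g (t * s) - h (t * s))); nra.
Qed.

Lemma ball_average_const n (c t : R) : (1 <= n)%nat ->
  ball_average n (fun _ => c) t = c / INR n.
Proof.
  intros Hn; unfold ball_average, average.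
  assert (Hn0 : INR n <> 0) by (apply not_0_INR; lia).
  apply is_RInt_unique.
  replace (c / INR n) with (minus (c / INR n * 1 ^ n) (c / INR n * 0 ^ n)).
  2:{ rewrite pow1, pow_i by lia; unfold minus, plus, opp; simpl; ring. }
  apply (is_RInt_derive (fun s => c / INR n * s ^ n) (fun s => s ^ (n - 1) * c)).
  - intros s _; auto_derive; [easy |].
    replace (Init.Nat.pred n) with (n - 1)%nat by lia; field; easy.
  - intros s _; apply (continuous_mult (fun s => s ^ (n - 1)) (fun _ => c)).
    + apply continuous_pow.
    + apply continuous_const.
Qed.

Lemma ball_average_at0 n (g : R -> R) : (1 <= n)%nat -> ball_average n g 0 = g 0 / INR n.
Proof.
  intros Hn; rewrite <- (ball_average_const n (g 0) 0 Hn).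
  apply RInt_ext; intros s _; now rewrite Rmult_0_l.
Qed.

Lemma pow_pred_mul n (t : R) : (1 <= n)%nat -> t ^ n = t * t ^ (n - 1).
Proof. intros Hn; destruct n; [lia |]; simpl; now rewrite Nat.sub_0_r. Qed.

(** The substitution of t s for s extracts the power t^n and leaves a factor that stays continuous
    down to t = 0. *)
Lemma inner_integral_ball_average n (f U : R -> R) (t : R) : (1 <= n)%nat ->
  (forall x, continuous (fun s => f (U s)) x) ->
  inner_integral n f U t = t ^ n * ball_average n (fun s => f (U s)) t.
Proof.
  intros Hn Hc; unfold inner_integral.
  assert (Hi : forall a b, ex_RInt (fun s => s ^ (n - 1) * f (U s)) a b).
  { intros; apply continuous_ex_RInt; intro.
    apply (continuous_mult (fun s => s ^ (n - 1)) (fun s => f (U s))); auto using continuous_pow. }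
  pose proof (RInt_comp_lin (V := R_CompleteNormedModule)
    (fun s => s ^ (n - 1) * f (U s)) t 0 0 1 (Hi _ _)) as H.
  rewrite Rmult_0_r, Rmult_1_r, !Rplus_0_r in H; rewrite <- H.
  unfold ball_average, average; symmetry.
  rewrite <- (RInt_scal (V := R_CompleteNormedModule)
    (fun s => s ^ (n - 1) * f (U (t * s)))) by now apply (ex_RInt_ball_average n (fun s => f (U s))).
  apply RInt_ext; intros s _; unfold scal; simpl; unfold mult; simpl.
  rewrite Rplus_0_r, Rpow_mult_distr, (pow_pred_mul n t Hn); ring.
Qed.

(** Quotient rule for the integral of s^(n-1) g(s) over [0, t], which is [inner_integral] with the
    identity as [U], divided by t^n. Differentiating inside the average would require a derivative
    of g; the fundamental theorem of calculus only asks for continuity. *)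
Lemma is_derive_ball_average n (g : R -> R) (t : R) : (1 <= n)%nat ->
  (forall x, continuous g x) -> 0 < t ->
  is_derive (ball_average n g) t ((g t - INR n * ball_average n g t) / t).
Proof.
  intros Hn Hg Ht.
  assert (He : forall s, 0 < s -> ball_average n g s = inner_integral n g (fun x => x) s / s ^ n).
  { intros s Hs; rewrite inner_integral_ball_average by auto.
    change (fun s0 : R => g s0) with g; field; apply pow_nonzero; lra. }
  apply is_derive_ext_loc with (fun s => inner_integral n g (fun x => x) s / s ^ n).
  { apply (locally_interval _ t 0 p_infty); simpl; auto; intros s Hs _; symmetry; auto. }
  assert (Hd : is_derive (inner_integral n g (fun x => x)) t (t ^ (n - 1) * g t)).
  { apply (is_derive_RInt_upper (fun s => s ^ (n - 1) * g s)); intro.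
    apply (continuous_mult (fun s => s ^ (n - 1)) g); auto using continuous_pow. }
  rewrite (He t Ht).
  assert (Htn : t ^ (n - 1) <> 0) by (apply pow_nonzero; lra).
  replace ((g t - _) / t) with
    ((t ^ (n - 1) * g t * t ^ n - inner_integral n g (fun x => x) t * (INR n * t ^ (n - 1))) / (t ^ n) ^ 2).
  2:{ rewrite (pow_pred_mul n t Hn); field; split; [easy | lra]. }
  apply (is_derive_div (inner_integral n g (fun x => x)) (fun s => s ^ n)); auto.
  - auto_derive; [easy |]; replace (Init.Nat.pred n) with (n - 1)%nat by lia; ring.
  - apply pow_nonzero; lra.
Qed.

(* For [g = f o U], minus the derivative of the solution [U]. *)
Definition slope (n : nat) (q : R) (g : R -> R) (t : R) : R :=
  apow q t * apow q (ball_average n g t).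

Lemma continuous_slope n q (g : R -> R) : 0 < q ->
  (forall x, continuous g x) -> forall t, continuous (slope n q g) t.
Proof.
  intros Hq Hg t; apply (continuous_mult (apow q) (fun t => apow q (ball_average n g t))).
  - now apply continuous_apow.
  - apply (continuous_comp (ball_average n g) (apow q)); [now apply continuous_ball_average |].
    now apply continuous_apow.
Qed.

Lemma slope_ge0 n q (g : R -> R) (t : R) : 0 <= slope n q g t.
Proof. apply Rmult_le_pos; apply apow_ge0. Qed.

(** * Limits with geometric error *)

(** The intervals with centre a_k and radius 2 B / 2^k are nested, and l is the supremum of their
    left ends. The limit comes in an informative pair rather than an existential, so that pointwise
    limits define a function without any choice. *)
Lemma geometric_limit (a : nat -> R) (B : R) :
  (forall k, Rabs (a (S k) - a k) <= B / 2 ^ k) ->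
  {l : R | forall k, Rabs (a k - l) <= 2 * B / 2 ^ k}.
Proof.
  intros H.
  assert (Hstep : forall k, a k - 2 * B / 2 ^ k <= a (S k) - 2 * B / 2 ^ S k /\
                            a (S k) + 2 * B / 2 ^ S k <= a k + 2 * B / 2 ^ k).
  { intro k; pose proof (H k) as Hk; apply Rabs_le_between in Hk.
    replace (2 * B / 2 ^ S k) with (B / 2 ^ k) by (simpl; field; apply pow_nonzero; lra).
    replace (2 * B / 2 ^ k) with (2 * (B / 2 ^ k)) by (field; apply pow_nonzero; lra); lra. }
  assert (Hmono : forall j k, a k - 2 * B / 2 ^ k <= a (j + k)%nat - 2 * B / 2 ^ (j + k) /\
                              a (j + k)%nat + 2 * B / 2 ^ (j + k) <= a k + 2 * B / 2 ^ k).
  { induction j as [| j IH]; intro k; [simpl; lra |].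
    specialize (IH k); specialize (Hstep (j + k)%nat); simpl Nat.add; lra. }
  assert (HB : forall k, 0 <= 2 * B / 2 ^ k).
  { intro k; pose proof (H O) as H0; pose proof (Rabs_pos (a 1%nat - a O)) as H1.
    simpl in H0; apply Rle_mult_inv_pos; [lra | apply pow_lt; lra]. }
  assert (Hcross : forall j k, a j - 2 * B / 2 ^ j <= a k + 2 * B / 2 ^ k).
  { intros j k; destruct (Hmono j k) as [_ H1], (Hmono k j) as [H2 _].
    rewrite Nat.add_comm in H2; pose proof (HB (j + k)%nat); lra. }
  destruct (completeness (fun x => exists j, x = a j - 2 * B / 2 ^ j)) as [l [Hub Hlub]].
  - exists (a O + 2 * B / 2 ^ O); intros x [j ->]; apply Hcross.
  - exists (a O - 2 * B / 2 ^ O), O; easy.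
  - exists l; intro k; apply Rabs_le_between'.
    assert (l <= a k + 2 * B / 2 ^ k) by (apply Hlub; intros x [j ->]; apply Hcross).
    assert (a k - 2 * B / 2 ^ k <= l) by (apply Hub; now exists k).
    lra.
Qed.

Lemma le_geometric (a b B : R) : (forall k : nat, a <= b + B / 2 ^ k) -> a <= b.
Proof.
  intros H; apply Rnot_lt_le; intro Hlt.
  assert (Hlim : is_lim_seq (fun k => b + B * (/ 2) ^ k) b).
  { replace (Finite b) with (Finite (b + B * 0)) by (f_equal; ring).
    apply (is_lim_seq_plus' (fun _ => b)); [apply is_lim_seq_const |].
    apply (is_lim_seq_scal_l _ B 0), is_lim_seq_geom; rewrite Rabs_pos_eq; lra. }
  pose proof (is_lim_seq_le (fun _ => a) (fun k => b + B * (/ 2) ^ k) a b) as Hle; simpl in Hle.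
  enough (a <= b) by lra.
  apply Hle; [| apply is_lim_seq_const | exact Hlim].
  intro k; rewrite pow_inv; apply H.
Qed.

(** * Picard iteration *)

Section Picard.
Variables (n : nat) (q alpha m M L K delta : R) (h : R -> R).
Hypothesis n_ge1 : (1 <= n)%nat.
Hypothesis q_bounds : 0 < q <= 1.
Hypothesis m_pos : 0 < m.
Hypothesis h_bounds : forall x, m <= h x <= M.
Hypothesis h_lipschitz : forall x y, Rabs (h x - h y) <= L * Rabs (x - y).
Hypothesis L_ge0 : 0 <= L.
Hypothesis K_ge0 : 0 <= K.
Hypothesis apow_lip : forall x y, m / INR n <= x -> m / INR n <= y ->
  Rabs (apow q x - apow q y) <= K * Rabs (x - y).
Hypothesis delta_bounds : 0 < delta <= 1.
Hypothesis delta_contract : delta * (K * L) <= / 2.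

Let INR_ge1 : 1 <= INR n.
Proof. apply (le_INR 1), n_ge1. Qed.

Lemma continuous_h_comp (U : R -> R) :
  (forall x, continuous U x) -> forall x, continuous (fun s => h (U s)) x.
Proof.
  intros HU x; apply (continuous_comp U h); auto; now apply (lipschitz_continuous L).
Qed.

Lemma ball_average_bounds (U : R -> R) (t : R) : (forall x, continuous U x) ->
  m / INR n <= ball_average n (fun s => h (U s)) t <= M.
Proof.
  intros HU; pose proof (continuous_h_comp U HU) as Hc; split.
  - rewrite <- (ball_average_const n m t n_ge1).
    apply ball_average_le; auto; [intro; apply continuous_const |].
    intros; apply h_bounds.
  - apply Rle_trans with (M / INR n).
    + rewrite <- (ball_average_const n M t n_ge1).
      apply ball_average_le; auto; [intro; apply continuous_const |].
      intros; apply h_bounds.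
    + pose proof (h_bounds 0); apply Rle_div_l; [lra | nra].
Qed.

Lemma slope_le (U : R -> R) (t : R) : (forall x, continuous U x) -> 0 <= t <= delta ->
  slope n q (fun s => h (U s)) t <= 1 + M.
Proof.
  intros HU Ht; unfold slope; destruct (ball_average_bounds U t HU) as [H1 H2].
  assert (0 < m / INR n) by (apply Rdiv_lt_0_compat; lra).
  pose proof (apow_le_1p q _ q_bounds (Rle_trans _ _ _ (Rlt_le _ _ H) H1)).
  assert (apow q t <= 1) by (apply apow_le1; [lra | rewrite Rabs_pos_eq; lra]).
  pose proof (apow_ge0 q t); pose proof (apow_ge0 q (ball_average n (fun s => h (U s)) t)).
  nra.
Qed.

(** Four factors combine: t^q <= 1, the Lipschitz constant K of x^q above m/n, the Lipschitz
    constant L of [h], and the length r <= delta of the interval; [delta_contract] makes their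
    product at most 1/2. *)
Lemma slope_contraction (U V : R -> R) (r B : R) :
  (forall x, continuous U x) -> (forall x, continuous V x) -> 0 <= r <= delta ->
  (forall x, 0 <= x <= r -> Rabs (U x - V x) <= B) ->
  Rabs (RInt (slope n q (fun s => h (U s))) 0 r - RInt (slope n q (fun s => h (V s))) 0 r)
    <= B / 2.
Proof.
  intros HU HV Hr HB.
  pose proof (continuous_h_comp U HU) as HcU; pose proof (continuous_h_comp V HV) as HcV.
  assert (HB0 : 0 <= B) by (apply Rle_trans with (2 := HB 0 ltac:(lra)), Rabs_pos).
  apply Rle_trans with ((r - 0) * (K * (L * B))).
  - apply RInt_dist; try lra;
      try (apply continuous_ex_RInt, continuous_slope; [lra | assumption]).
    intros t Ht; unfold slope.
    rewrite <- Rmult_minus_distr_l, Rabs_mult, (Rabs_pos_eq (apow q t)) by apply apow_ge0.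
    assert (Ht1 : apow q t <= 1) by (apply apow_le1; [lra | rewrite Rabs_pos_eq; lra]).
    assert (HJ : Rabs (ball_average n (fun s => h (U s)) t - ball_average n (fun s => h (V s)) t)
                 <= L * B).
    { apply ball_average_dist; auto; intros s Hs.
      apply Rle_trans with (1 := h_lipschitz _ _).
      apply Rmult_le_compat_l; auto; apply HB; nra. }
    pose proof (apow_lip _ _ (proj1 (ball_average_bounds U t HU))
                             (proj1 (ball_average_bounds V t HV))) as Hlip.
    pose proof (apow_ge0 q t).
    apply Rle_trans with (1 * (K * (L * B))); [| lra].
    apply Rmult_le_compat; auto using Rabs_pos.
    apply Rle_trans with (1 := Hlip); apply Rmult_le_compat_l; auto.
  - assert (0 <= K * L) by now apply Rmult_le_pos.
    replace ((r - 0) * (K * (L * B))) with (r * (K * L) * B) by ring.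
    assert (r * (K * L) <= / 2) by nra.
    nra.
Qed.

(** Freezing arguments outside [0, delta] keeps the iterates globally Lipschitz, so continuity can
    be required on all of R. The same device later extends an arbitrary solution given on [0, b). *)
Definition clamp (r : R) : R := Rmax 0 (Rmin r delta).

Lemma clamp_bounds r : 0 <= clamp r <= delta.
Proof. unfold clamp, Rmax, Rmin; repeat destruct Rle_dec; lra. Qed.

Lemma clamp_id r : 0 <= r <= delta -> clamp r = r.
Proof. unfold clamp, Rmax, Rmin; repeat destruct Rle_dec; lra. Qed.

Lemma clamp_mono x y : x <= y -> 0 <= clamp y - clamp x <= y - x.
Proof. unfold clamp, Rmax, Rmin; repeat destruct Rle_dec; lra. Qed.

Definition picard (U : R -> R) (r : R) : R :=
  alpha - RInt (slope n q (fun s => h (U s))) 0 (clamp r).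

Lemma picard_lipschitz (U : R -> R) : (forall x, continuous U x) ->
  forall x y, Rabs (picard U x - picard U y) <= (1 + M) * Rabs (x - y).
Proof.
  intros HU.
  assert (H : forall x y, x <= y -> Rabs (picard U x - picard U y) <= (1 + M) * (y - x)).
  { intros x y Hxy; unfold picard.
    set (F := slope n q (fun s => h (U s))).
    assert (HF : forall a b, ex_RInt F a b).
    { intros; apply continuous_ex_RInt, continuous_slope; [lra |]; now apply continuous_h_comp. }
    pose proof (RInt_Chasles (V := R_CompleteNormedModule) F 0 (clamp x) (clamp y)
      (HF _ _) (HF _ _)) as HC; change (RInt F 0 (clamp x) + RInt F (clamp x) (clamp y) = RInt F 0 (clamp y)) in HC.
    rewrite <- HC.
    assert (E : forall A B : R, alpha - A - (alpha - (A + B)) = B) by (intros; ring).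
    rewrite E.
    pose proof (clamp_mono x y Hxy); pose proof (clamp_bounds x); pose proof (clamp_bounds y).
    apply Rle_trans with ((clamp y - clamp x) * (1 + M)).
    - apply abs_RInt_le_const; [lra | apply HF |].
      intros t Ht; rewrite Rabs_pos_eq by apply slope_ge0; apply slope_le; auto; lra.
    - pose proof (h_bounds 0); nra. }
  intros x y; destruct (Rle_dec x y) as [Hxy | Hxy].
  - rewrite (Rabs_minus_sym x y), (Rabs_pos_eq (y - x)) by lra; auto.
  - rewrite (Rabs_minus_sym (picard U x)), (Rabs_pos_eq (x - y)) by lra; apply H; lra.
Qed.

Fixpoint picard_iter (k : nat) : R -> R :=
  match k with O => fun _ => alpha | S k' => picard (picard_iter k') end.

Lemma picard_iter_lipschitz k :
  forall x y, Rabs (picard_iter k x - picard_iter k y) <= (1 + M) * Rabs (x - y).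
Proof.
  induction k as [| k IH].
  - intros x y; simpl; rewrite Rminus_diag, Rabs_R0; pose proof (h_bounds 0).
    apply Rmult_le_pos; [lra | apply Rabs_pos].
  - now apply picard_lipschitz, (lipschitz_continuous (1 + M)).
Qed.

Lemma picard_iter_step k x :
  Rabs (picard_iter (S k) x - picard_iter k x) <= (1 + M) / 2 ^ k.
Proof.
  assert (Hc : forall k, forall x, continuous (picard_iter k) x).
  { intro; apply (lipschitz_continuous (1 + M)), picard_iter_lipschitz. }
  revert x; induction k as [| k IH]; intro x.
  (* The first increment is measured from the value alpha at 0: [picard_iter 1] moves away from it
     by at most (1 + M) delta, and delta <= 1. *)
  - assert (H0 : picard_iter 1 0 = alpha).
    { simpl; unfold picard; rewrite clamp_id by lra.
      rewrite (RInt_point (V := R_CompleteNormedModule)); unfold zero; simpl; ring. }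
    simpl picard_iter at 2; rewrite <- H0.
    replace (picard_iter 1 x) with (picard_iter 1 (clamp x)).
    2:{ simpl; unfold picard; now rewrite (clamp_id (clamp x)) by apply clamp_bounds. }
    apply Rle_trans with (1 := picard_iter_lipschitz 1 _ _).
    pose proof (clamp_bounds x); rewrite Rminus_0_r, Rabs_pos_eq by lra.
    pose proof (h_bounds 0); simpl; nra.
  - change (Rabs (picard (picard_iter (S k)) x - picard (picard_iter k) x) <= (1 + M) / 2 ^ S k).
    unfold picard.
    replace ((1 + M) / 2 ^ S k) with ((1 + M) / 2 ^ k / 2) by (simpl; field; apply pow_nonzero; lra).
    rewrite <- Rabs_Ropp.
    replace (- (_ - _)) with (RInt (slope n q (fun s => h (picard_iter (S k) s))) 0 (clamp x) -
      RInt (slope n q (fun s => h (picard_iter k s))) 0 (clamp x)) by ring.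
    apply slope_contraction; auto using clamp_bounds.
Qed.

Lemma picard_fixed_point :
  exists U : R -> R, (forall x, continuous U x) /\
    forall r, 0 <= r <= delta -> U r = alpha - RInt (slope n q (fun s => h (U s))) 0 r.
Proof.
  set (B := 2 * (1 + M)).
  set (lim := fun x => geometric_limit (fun k => picard_iter k x) (1 + M)
                         (fun k => picard_iter_step k x)).
  set (U := fun x => proj1_sig (lim x)).
  assert (HU : forall x k, Rabs (picard_iter k x - U x) <= B / 2 ^ k).
  { intros x k; unfold U; destruct (lim x) as [l Hl]; apply Hl. }
  assert (HUc : forall x, continuous U x).
  { apply (lipschitz_continuous (1 + M)); intros x y.
    (* The Lipschitz bound of the iterates survives in the limit; the errors at x and y add up to 2
       B / 2^k. *)
    apply (le_geometric _ _ (2 * B)); intro k.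
    replace (U x - U y) with ((picard_iter k x - picard_iter k y)
      + (- (picard_iter k x - U x) + (picard_iter k y - U y))) by ring.
    pose proof (HU x k); pose proof (HU y k); pose proof (picard_iter_lipschitz k x y).
    eapply Rle_trans; [apply Rabs_triang |].
    apply Rplus_le_compat; auto.
    eapply Rle_trans; [apply Rabs_triang |]; rewrite Rabs_Ropp; lra. }
  exists U; split; auto; intros r Hr.
  set (I := RInt (slope n q (fun s => h (U s))) 0 r).
  enough (H : Rabs (U r - (alpha - I)) <= 0).
  { pose proof (Rabs_pos (U r - (alpha - I))).
    apply Rminus_diag_uniq; destruct (Req_dec (U r - (alpha - I)) 0); auto.
    pose proof (Rabs_pos_lt _ H1); lra. }
  (* [U r] is close to iterate k + 1 as its limit, and [alpha - I] is close to it by the contraction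
     applied to iterate k and [U]; each distance is at most B / 2^(k+1). *)
  apply (le_geometric _ _ B); intro k.
  pose proof (HU r (S k)) as H1.
  assert (H2 : Rabs (picard_iter (S k) r - (alpha - I)) <= B / 2 ^ k / 2).
  { simpl; unfold picard; rewrite clamp_id by easy.
    replace (alpha - _ - (alpha - I)) with
      (- (RInt (slope n q (fun s => h (picard_iter k s))) 0 r - I)) by ring.
    rewrite Rabs_Ropp; apply slope_contraction; auto.
    apply (lipschitz_continuous (1 + M)), picard_iter_lipschitz. }
  replace (B / 2 ^ S k) with (B / 2 ^ k / 2) in H1 by (simpl; field; apply pow_nonzero; lra).
  replace (U r - _) with (- (picard_iter (S k) r - U r) + (picard_iter (S k) r - (alpha - I))) by ring.
  eapply Rle_trans; [apply Rabs_triang |]; rewrite Rabs_Ropp; lra.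
Qed.

(** Every use of the contraction halves the bound on the difference over [0, r], so any initial
    bound B forces equality. *)
Lemma picard_unique (U V : R -> R) (r B : R) :
  (forall x, continuous U x) -> (forall x, continuous V x) -> 0 <= r <= delta ->
  (forall x, 0 <= x <= r -> U x = alpha - RInt (slope n q (fun s => h (U s))) 0 x) ->
  (forall x, 0 <= x <= r -> V x = alpha - RInt (slope n q (fun s => h (V s))) 0 x) ->
  (forall x, 0 <= x <= r -> Rabs (U x - V x) <= B) ->
  U r = V r.
Proof.
  intros HU HV Hr EU EV HB.
  assert (H : forall k x, 0 <= x <= r -> Rabs (U x - V x) <= B / 2 ^ k).
  { induction k as [| k IH]; intros x Hx.
    - simpl; rewrite Rdiv_1_r; auto.
    - rewrite EU, EV by easy.
      replace (_ - _) with (- (RInt (slope n q (fun s => h (U s))) 0 x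
        - RInt (slope n q (fun s => h (V s))) 0 x)) by ring.
      replace (B / 2 ^ S k) with (B / 2 ^ k / 2) by (simpl; field; apply pow_nonzero; lra).
      rewrite Rabs_Ropp; apply slope_contraction; auto; try lra.
      intros; apply IH; lra. }
  assert (H0 : Rabs (U r - V r) <= 0).
  { apply (le_geometric _ _ B); intro k; rewrite Rplus_0_l; apply H; lra. }
  apply Rminus_diag_uniq; destruct (Req_dec (U r - V r) 0) as [| Hne]; auto.
  pose proof (Rabs_pos_lt _ Hne); lra.
Qed.

End Picard.

(** * Localization of solutions near the starting value *)

Lemma ball_average_ext n (g h : R -> R) (r t : R) : 0 <= t <= r ->
  (forall x, 0 <= x <= r -> g x = h x) -> ball_average n g t = ball_average n h t.
Proof.
  intros Ht H; apply RInt_ext; intros s; rewrite Rmin_left, Rmax_right by lra.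
  intros Hs; rewrite H; [easy | nra].
Qed.

Lemma RInt_slope_ext n q (g h : R -> R) (r : R) : 0 <= r ->
  (forall x, 0 <= x <= r -> g x = h x) ->
  RInt (slope n q g) 0 r = RInt (slope n q h) 0 r.
Proof.
  intros Hr H; apply RInt_ext; intros t; rewrite Rmin_left, Rmax_right by lra.
  intros Ht; unfold slope; now rewrite (ball_average_ext n g h r) by (lra || auto).
Qed.

Lemma continuous_comp_R (f U : R -> R) :
  (forall x, continuous f x) -> (forall x, continuous U x) ->
  forall x, continuous (fun s => f (U s)) x.
Proof. intros Hf HU x; apply (continuous_comp U f); [apply HU | apply Hf]. Qed.

(* [W] is nonincreasing, so [f (W s) <= f alpha + L (alpha - W r)] on [0, r]; the
   integral equation then bounds [alpha - W r] in terms of itself with a factor [r L < 1]. *)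
Lemma solution_near_start n q alpha L r (f W : R -> R) :
  (1 <= n)%nat -> 0 < q <= 1 -> 0 <= L ->
  (forall x y, Rabs (f x - f y) <= L * Rabs (x - y)) -> 0 < f alpha ->
  0 <= r <= 1 -> r * L <= / 2 -> (forall x, continuous W x) ->
  (forall x, 0 <= x <= r -> W x = alpha - RInt (slope n q (fun s => f (W s))) 0 x) ->
  (forall x, 0 <= x <= r -> 0 <= ball_average n (fun s => f (W s)) x) ->
  0 <= alpha - W r <= 2 * r * (1 + f alpha).
Proof.
  intros Hn Hq HL Hlip Hfa Hr HrL HW HE HJ.
  set (g := fun s => f (W s)) in *.
  assert (Hg : forall x, continuous g x).
  { apply (continuous_comp_R f W); [now apply (lipschitz_continuous L) | exact HW]. }
  set (F := slope n q g) in *.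
  assert (HF : forall a b, ex_RInt F a b).
  { intros; apply continuous_ex_RInt, continuous_slope; [lra | exact Hg]. }
  assert (Hmono : forall x y, 0 <= x <= y -> y <= r -> W y <= W x).
  { intros x y Hxy Hyr; rewrite (HE x), (HE y) by lra.
    pose proof (RInt_Chasles (V := R_CompleteNormedModule) F 0 x y (HF _ _) (HF _ _)) as HC.
    change (RInt F 0 x + RInt F x y = RInt F 0 y) in HC; rewrite <- HC.
    assert (0 <= RInt F x y) by (apply RInt_ge_0; [lra | apply HF | intros; apply slope_ge0]).
    apply Rplus_le_compat_l, Ropp_le_contravar; lra. }
  assert (HW0 : W 0 = alpha).
  { rewrite HE by lra; rewrite (RInt_point (V := R_CompleteNormedModule)).
    unfold zero; simpl; ring. }
  set (w := alpha - W r).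
  assert (Hw0 : 0 <= w) by (pose proof (Hmono 0 r); unfold w; lra).
  assert (Hgle : forall s, 0 <= s <= r -> g s <= f alpha + L * w).
  { intros s Hs; pose proof (Hlip (W s) alpha) as H.
    pose proof (Hmono 0 s) as H1; pose proof (Hmono s r) as H2.
    rewrite (Rabs_left1 (W s - alpha)) in H by lra.
    pose proof (Rle_abs (f (W s) - f alpha)); unfold g.
    assert (L * - (W s - alpha) <= L * w) by (apply Rmult_le_compat_l; unfold w; lra).
    lra. }
  assert (Hn1 : 1 <= INR n) by (apply (le_INR 1), Hn).
  assert (HJle : forall t, 0 <= t <= r -> ball_average n g t <= f alpha + L * w).
  { intros t Ht; apply Rle_trans with ((f alpha + L * w) / INR n).
    - rewrite <- (ball_average_const n _ t Hn); apply ball_average_le; auto.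
      + intro; apply continuous_const.
      + intros s Hs; apply Hgle; nra.
    - pose proof (Rmult_le_pos _ _ HL Hw0); apply Rle_div_l; [lra | nra]. }
  assert (HI : Rabs (RInt F 0 r) <= (r - 0) * (1 + (f alpha + L * w))).
  { apply abs_RInt_le_const; [lra | apply HF |].
    intros t Ht; rewrite Rabs_pos_eq by apply slope_ge0; unfold F, slope.
    pose proof (apow_le_1p q _ Hq (HJ t Ht)); pose proof (HJle t Ht).
    assert (apow q t <= 1) by (apply apow_le1; [lra | rewrite Rabs_pos_eq; lra]).
    pose proof (apow_ge0 q t); pose proof (apow_ge0 q (ball_average n g t)); nra. }
  pose proof (Rle_abs (RInt F 0 r)) as H1.
  assert (Hw : w = RInt F 0 r) by (unfold w; rewrite (HE r) by lra; simpl; lra).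
  rewrite <- Hw in *; split; [exact Hw0 |].
  (* The part proportional to w is at most w / 2; absorbing it on the left produces the factor 2 of
     the conclusion. *)
  replace ((r - 0) * (1 + (f alpha + L * w))) with (r * (1 + f alpha) + r * L * w) in HI by ring.
  assert (r * L * w <= / 2 * w) by now apply Rmult_le_compat_r.
  lra.
Qed.

(** The difference quotient of z k(z) at 0 is k(z) itself, so continuity suffices. This serves at z
    = 0, where a derivative of [mean] is not at hand. *)
Lemma is_derive_id_mult_at0 (k : R -> R) :
  continuous k 0 -> is_derive (fun z => z * k z) 0 (k 0).
Proof.
  intros Hk; apply is_derive_Reals; intros e He.
  apply continuity_pt_filterlim in Hk.
  destruct (Hk e He) as [d [Hd H]]; exists (mkposreal d Hd).
  intros z Hz0 Hz; simpl in *; unfold R_dist in H.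
  rewrite Rplus_0_l, Rmult_0_l, Rminus_0_r.
  replace (z * k z / z) with (k z) by now field.
  apply H; split; [split; [exact I | now apply not_eq_sym] | now rewrite Rminus_0_r].
Qed.

(** * Regularity in the variable z *)

Section Profile.
Variables (n : nat) (q beta alpha : R) (g : R -> R).
Hypothesis n_ge1 : (1 <= n)%nat.
Hypothesis q_bounds : 0 < q <= 1.
Hypothesis beta_gt1 : 1 < beta.
Hypothesis beta_q : beta * (1 + q) = 2.
Hypothesis g_cont : forall x, continuous g x.
Hypothesis average_pos : forall t, 0 < ball_average n g t.

(* [radial] is the U of the theorem, [profile] its u and [mean] the H of the header, all
   extended to the whole line. *)
Definition radial (r : R) : R := alpha - RInt (slope n q g) 0 r.

Lemma is_derive_radial r : is_derive radial r (- slope n q g r).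
Proof.
  replace (- slope n q g r) with (0 - slope n q g r) by ring.
  apply (is_derive_minus (fun _ => alpha) (fun r => RInt (slope n q g) 0 r)).
  - apply (is_derive_const alpha).
  - apply is_derive_RInt_upper, continuous_slope; [lra | exact g_cont].
Qed.

Definition profile (z : R) : R := radial (apow beta z).
Definition mean (z : R) : R := ball_average n g (apow beta z).
Definition profile' (z : R) : R := z * (- beta * apow q (mean z)).
Definition profile'' (z : R) : R :=
  - beta * apow q (mean z)
  + - (beta * q) * (apow (q - 1) (mean z) * (beta * (g (apow beta z) - INR n * mean z))).

Lemma apow_beta_eq z : apow beta z = z * z * apow (beta - 2) z.
Proof.
  destruct (Req_dec z 0) as [-> | Hz]; [rewrite apow_at0; lra |].
  replace beta with (1 + 1 + (beta - 2)) at 1 by ring.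
  rewrite !apow_plus, apow_1 by easy; f_equal.
  rewrite <- Rabs_mult, Rabs_pos_eq; [easy | apply Rle_0_sqr].
Qed.

Lemma is_derive_profile z : is_derive profile z (profile' z).
Proof.
  assert (H : is_derive profile z
    (scal (beta * (z * apow (beta - 2) z)) (- slope n q g (apow beta z)))).
  { apply (is_derive_comp radial (apow beta)); [apply is_derive_radial |].
    now apply is_derive_apow. }
  replace (profile' z) with (scal (beta * (z * apow (beta - 2) z)) (- slope n q g (apow beta z))); auto.
  unfold scal, profile', slope; simpl; unfold mult; simpl; fold (mean z).
  destruct (Req_dec z 0) as [-> | Hz]; [ring |].
  rewrite apow_apow by lra.
  (* This is where beta (1 + q) = 2 enters: the exponents q beta and beta - 2 cancel, which leaves
     the smooth factor z. *)
  assert (E : apow (q * beta) z * apow (beta - 2) z = 1).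
  { rewrite <- apow_plus by easy; replace (q * beta + (beta - 2)) with 0 by lra.
    rewrite apow_neq0 by easy; now apply Rpower_O, Rabs_pos_lt. }
  replace (_ * _) with (- (beta * z * apow q (mean z)
    * (apow (q * beta) z * apow (beta - 2) z))) by ring.
  rewrite E; ring.
Qed.

Lemma continuous_g_apow z : continuous (fun z => g (apow beta z)) z.
Proof. apply (continuous_comp (apow beta) g); [apply continuous_apow; lra | apply g_cont]. Qed.

Lemma continuous_mean z : continuous mean z.
Proof.
  apply (continuous_comp (apow beta) (ball_average n g)).
  - apply continuous_apow; lra.
  - now apply continuous_ball_average.
Qed.

Lemma mean_pos z : 0 < mean z.
Proof. apply average_pos. Qed.

Lemma continuous_apow_mean a z : continuous (fun z => apow a (mean z)) z.
Proof.
  apply (continuous_comp mean (apow a)); [apply continuous_mean |].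
  apply (smooth_on_continuous 0 (Rlt 0) (apow a)); [apply smooth_on_apow | apply mean_pos].
Qed.

(** The logarithmic derivative of r = |z|^beta is beta / z, so t J' = g - n J becomes z H' = beta (g
    - n H), with no derivative of g. *)
Lemma is_derive_mean z : z <> 0 ->
  is_derive mean z (beta * (g (apow beta z) - INR n * mean z) / z).
Proof.
  intros Hz.
  assert (H : is_derive mean z (scal (beta * (z * apow (beta - 2) z))
    ((g (apow beta z) - INR n * ball_average n g (apow beta z)) / apow beta z))).
  { apply (is_derive_comp (ball_average n g) (apow beta)); [| now apply is_derive_apow].
    apply is_derive_ball_average; auto; now apply apow_gt0. }
  revert H; fold (mean z); unfold scal; simpl; unfold mult; simpl.
  set (X := g (apow beta z) - INR n * mean z).
  replace (beta * X / z) with (beta * (z * apow (beta - 2) z) * (X / apow beta z)); auto.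
  pose proof (apow_gt0 (beta - 2) z Hz); rewrite apow_beta_eq; field; lra.
Qed.

Lemma is_derive_profile' z : is_derive profile' z (profile'' z).
Proof.
  destruct (Req_dec z 0) as [-> | Hz].
  - replace (profile'' 0) with (- beta * apow q (mean 0)).
    + apply (is_derive_id_mult_at0 (fun z => - beta * apow q (mean z))).
      apply (continuous_scal_r (- beta) (fun z => apow q (mean z))), continuous_apow_mean.
    (* At 0 the average is g(0) / n, so g - n H vanishes and the second term of [profile''] drops
       out. *)
    + unfold profile''.
      replace (g (apow beta 0) - INR n * mean 0) with 0; [ring |].
      unfold mean; rewrite apow_at0, ball_average_at0 by (lra || auto).
      field; apply not_0_INR; lia.
  - pose proof (is_derive_mean z Hz) as Hm.
    pose proof (is_derive_apow_pos q (mean z) (mean_pos z)) as Hp.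
    pose proof (is_derive_comp (apow q) mean z _ _ Hp Hm) as Hc.
    pose proof (is_derive_scal (fun z => apow q (mean z)) z (- beta) _ Hc) as Hs.
    pose proof (is_derive_mult (fun z => z) (fun z => - beta * apow q (mean z)) z _ _
      (is_derive_id (K := R_AbsRing) z) Hs Rmult_comm) as H.
    replace (profile'' z) with (plus (mult one (- beta * apow q (mean z)))
      (mult z (- beta * scal (beta * (g (apow beta z) - INR n * mean z) / z)
                             (q * apow (q - 1) (mean z))))); [exact H |].
    unfold profile'', plus, mult, one, scal; simpl; unfold mult; simpl; field; easy.
Qed.

Lemma continuous_profile'' z : continuous profile'' z.
Proof.
  apply (continuous_plus (fun z => - beta * apow q (mean z))
    (fun z => - (beta * q) * (apow (q - 1) (mean z) * (beta * (g (apow beta z) - INR n * mean z))))).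
  - apply (continuous_scal_r (- beta) (fun z => apow q (mean z))), continuous_apow_mean.
  - apply (continuous_scal_r (- (beta * q)) (fun z => apow (q - 1) (mean z)
      * (beta * (g (apow beta z) - INR n * mean z)))).
    apply (continuous_mult (fun z => apow (q - 1) (mean z))
      (fun z => beta * (g (apow beta z) - INR n * mean z))); [apply continuous_apow_mean |].
    apply (continuous_scal_r beta (fun z => g (apow beta z) - INR n * mean z)).
    apply (continuous_minus (fun z => g (apow beta z)) (fun z => INR n * mean z)).
    + apply continuous_g_apow.
    + apply (continuous_scal_r (INR n) mean), continuous_mean.
Qed.

Lemma smooth_on_profile_SS m (D : R -> Prop) :
  smooth_on m D profile'' -> smooth_on (S (S m)) D profile.
Proof.
  intros H; apply smooth_on_S with profile'; [intros; apply is_derive_profile |].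
  apply smooth_on_S with profile''; [intros; apply is_derive_profile' | exact H].
Qed.

(* On [|z| < d] the mean of [f o u] over balls is itself a weighted average of [f o u]
   along [0, z], so it inherits the smoothness of [f o u], and then so does [u'']. *)
Lemma smooth_on_profile (f : R -> R) (d : R) k :
  of_class_C k f ->
  (forall z, Rabs z < d -> g (apow beta z) = f (profile z)) ->
  smooth_on (S (S k)) (fun z => Rabs z < d) profile.
Proof.
  intros Hf Hgf; set (D := fun z => Rabs z < d).
  assert (Hib : 0 < / beta) by (apply Rinv_0_lt_compat; lra).
  assert (H01 : forall s, 0 <= s <= 1 -> 0 <= apow (/ beta) s <= 1).
  { intros s Hs; split; [apply apow_ge0 | apply apow_le1; auto; rewrite Rabs_pos_eq; lra]. }
  assert (HD : forall z, D z -> locally z D) by apply locally_Rabs_lt.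
  (* Raising |z| s^(1/beta) to the power beta gives |z|^beta s, so taking s^(1/beta) for [theta]
     turns the average in r into one in z. *)
  assert (Hmean : forall z, D z ->
    average (fun s => s ^ (n - 1)) (apow (/ beta)) (fun y => f (profile y)) z = mean z).
  { intros z Hz; apply RInt_ext; intros s; rewrite Rmin_left, Rmax_right by lra; intros Hs.
    rewrite <- Hgf; [now rewrite apow_mult, apow_apow, Rinv_r, apow_1, (Rabs_pos_eq s) by lra |].
    unfold D in Hz; rewrite Rabs_mult, (Rabs_pos_eq (apow (/ beta) s)) by apply apow_ge0.
    pose proof (H01 s ltac:(lra)); pose proof (Rabs_pos z); nra. }
  assert (Hboot : forall j, smooth_on j D (fun y => f (profile y)) -> smooth_on j D profile'').
  { intros j Hj.
    assert (Hm : smooth_on j D mean).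
    { apply (smooth_on_ext j D (average (fun s => s ^ (n - 1)) (apow (/ beta))
        (fun y => f (profile y)))); auto.
      apply smooth_on_average; auto using continuous_pow, continuous_apow. }
    assert (Hg : smooth_on j D (fun z => g (apow beta z))).
    { apply (smooth_on_ext j D (fun y => f (profile y))); auto.
      intros z Hz; symmetry; now apply Hgf. }
    assert (Ha : forall a, smooth_on j D (fun z => apow a (mean z))).
    { intro a; apply (smooth_on_comp j D (Rlt 0) (apow a) mean); auto using smooth_on_apow.
      intros; apply mean_pos. }
    apply smooth_on_plus.
    - apply smooth_on_mult; [apply smooth_on_const | apply Ha].
    - apply smooth_on_mult; [apply smooth_on_const |].
      apply smooth_on_mult; [apply Ha |].
      apply smooth_on_mult; [apply smooth_on_const |].
      apply (smooth_on_ext j D (fun z => g (apow beta z) + - INR n * mean z)); auto.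
      + intros; ring.
      + apply smooth_on_plus; auto; apply smooth_on_mult; auto; apply smooth_on_const. }
  assert (Hcomp : forall j, (j <= k)%nat -> smooth_on j D profile ->
    smooth_on j D (fun y => f (profile y))).
  { intros j Hj Hu; apply (smooth_on_comp j D (fun _ => True) f profile); auto.
    apply smooth_on_le with k; auto; now apply smooth_on_of_class_C. }
  (* The bootstrap gains one order per round: C^(j+2) for u is weakened to C^(j+1), passes to f o u
     and then to u'', and yields C^(j+3) for u. The start j = 0 uses the continuity of u'' alone. *)
  assert (H : forall j, (j <= k)%nat -> smooth_on (S (S j)) D profile).
  { induction j as [| j IH]; intros Hj; apply smooth_on_profile_SS.
    - split; [intros; apply continuous_profile'' | easy].
    - apply Hboot, Hcomp; auto; apply smooth_on_pred, IH; lia. }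
  now apply H.
Qed.

End Profile.

(** * The integral equation and the initial value problem *)

Lemma inner_integral_ext n (f U W : R -> R) (t : R) : 0 <= t ->
  (forall s, 0 <= s <= t -> U s = W s) ->
  inner_integral n f U t = inner_integral n f W t.
Proof.
  intros Ht H; apply RInt_ext; intros s; rewrite Rmin_left, Rmax_right by lra.
  intros Hs; now rewrite H by lra.
Qed.

(** The exponents of t combine to n q - (n - 1) q = q, so the singular factor cancels for t > 0; the
    point t = 0 is invisible to the integral. *)
Lemma integrand_slope n p (f W : R -> R) (t : R) :
  (1 <= n)%nat -> 2 < p -> (forall x, continuous (fun s => f (W s)) x) -> 0 < t ->
  0 <= inner_integral n f W t ->
  1 / rpow t ((INR n - 1) / (p - 1)) * rpow (inner_integral n f W t) (1 / (p - 1))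
    = slope n (1 / (p - 1)) (fun s => f (W s)) t.
Proof.
  intros Hn Hp Hc Ht HI.
  rewrite <- (apow_nonneg _ (inner_integral n f W t)), <- (apow_nonneg _ t) by lra.
  rewrite inner_integral_ball_average by auto.
  set (q := 1 / (p - 1)).
  assert (Hq : 0 < q) by (apply Rdiv_lt_0_compat; lra).
  rewrite apow_mult by lra; unfold slope; rewrite <- Rmult_assoc; f_equal.
  replace ((INR n - 1) / (p - 1)) with (q * (INR n - 1)) by (unfold q; field; lra).
  rewrite <- Rpower_pow, <- apow_pos, apow_apow by
    (try apply not_0_INR; try lia; lra).
  replace (INR n) with (1 + (INR n - 1)) at 2 by ring.
  rewrite Rmult_comm, (Rmult_comm q (1 + _)).
  replace ((1 + (INR n - 1)) * q) with (q + q * (INR n - 1)) by ring.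
  rewrite apow_plus by lra; pose proof (apow_gt0 (q * (INR n - 1)) t ltac:(lra)); field; lra.
Qed.

Lemma RInt_integrand_slope n p (f W : R -> R) (r : R) :
  (1 <= n)%nat -> 2 < p -> (forall x, continuous (fun s => f (W s)) x) -> 0 <= r ->
  (forall t, 0 <= t <= r -> 0 <= inner_integral n f W t) ->
  RInt (fun t => 1 / rpow t ((INR n - 1) / (p - 1))
    * rpow (inner_integral n f W t) (1 / (p - 1))) 0 r
  = RInt (slope n (1 / (p - 1)) (fun s => f (W s))) 0 r.
Proof.
  intros Hn Hp Hc Hr HI; apply RInt_ext; intros t; rewrite Rmin_left, Rmax_right by lra.
  intros Ht; apply integrand_slope; auto; try apply HI; lra.
Qed.

(** [clamp r] takes values in [0, r], inside [0, b), so continuity of [V] relative to [0, b) becomes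
    continuity on the whole line. *)
Lemma continuous_clamp_comp (b r : R) (V : R -> R) :
  0 < r <= 1 -> r < b -> continuous_on (Ico b) V ->
  forall x, continuous (fun x => V (clamp r x)) x.
Proof.
  intros Hr Hrb HV x.
  assert (Hc : continuous (clamp r) x).
  { apply (lipschitz_continuous 1); intros y z; rewrite Rmult_1_l.
    destruct (Rle_dec y z) as [H | H].
    - pose proof (clamp_mono r Hr y z H); rewrite !Rabs_left1; lra.
    - pose proof (clamp_mono r Hr z y ltac:(lra)); rewrite !Rabs_pos_eq; lra. }
  assert (HI : forall y, Ico b (clamp r y)).
  { intro y; pose proof (clamp_bounds r Hr y); unfold Ico; lra. }
  apply filterlim_comp with (G := within (Ico b) (locally (clamp r x))); [| apply HV, HI].
  intros P HP; specialize (Hc _ HP); revert Hc.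
  unfold filtermap; apply filter_imp; intros y Hy; apply Hy, HI.
Qed.

(* The integral equation on [0, r] for [V], restated for a globally continuous extension of
   [V] and without the singular factor. *)
Lemma integral_equation_clamp n p alpha b r (f V : R -> R) :
  (1 <= n)%nat -> 2 < p -> (forall x, continuous f x) -> 0 < f alpha ->
  0 < r <= 1 -> r < b -> continuous_on (Ico b) V -> integral_equation n p alpha f b V ->
  forall x, 0 <= x <= r ->
    V (clamp r x) = alpha - RInt (slope n (1 / (p - 1)) (fun s => f (V (clamp r s)))) 0 x /\
    0 <= ball_average n (fun s => f (V (clamp r s))) x.
Proof.
  intros Hn Hp Hf Hfa Hr Hrb HV [HI HE] x Hx.
  set (W := fun s => V (clamp r s)).
  assert (HVW : forall s, 0 <= s <= r -> V s = W s).
  { intros s Hs; unfold W; now rewrite clamp_id. }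
  assert (Hc : forall x, continuous (fun s => f (W s)) x).
  { apply (continuous_comp_R f W Hf); now apply continuous_clamp_comp with b. }
  assert (HIW : forall t, 0 <= t <= r -> inner_integral n f V t = inner_integral n f W t).
  { intros t Ht; apply inner_integral_ext; [lra |]; intros s Hs; apply HVW; lra. }
  assert (HIpos : forall t, 0 <= t <= r -> 0 <= inner_integral n f W t).
  { intros t Ht; rewrite <- HIW by easy; apply HI; unfold Ico; lra. }
  assert (HW : forall y, 0 <= y <= r ->
    W y = alpha - RInt (slope n (1 / (p - 1)) (fun s => f (W s))) 0 y).
  { intros y Hy; rewrite <- HVW, HE by (unfold Ico; lra); f_equal.
    rewrite <- (RInt_integrand_slope n p f W y); auto; try lra.
    - apply RInt_ext; intros t; rewrite Rmin_left, Rmax_right by lra; intros Ht.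
      now rewrite HIW by lra.
    - intros; apply HIpos; lra. }
  split; [now apply HW |].
  change (0 <= ball_average n (fun s => f (W s)) x).
  destruct (proj1 Hx) as [Hx0 | <-].
  - pose proof (HIpos x Hx) as H; rewrite inner_integral_ball_average in H by auto.
    pose proof (pow_lt x n Hx0).
    apply Rmult_le_reg_l with (x ^ n); [easy | now rewrite Rmult_0_r].
  (* Dividing by x^n is impossible at 0; there the average is f(alpha) / n, because V(0) = alpha. *)
  - rewrite ball_average_at0 by easy.
    rewrite (HW 0), (RInt_point (V := R_CompleteNormedModule)) by lra.
    unfold zero; simpl; rewrite Rminus_0_r; left; apply Rdiv_lt_0_compat; auto.
    apply lt_0_INR; lia.
Qed.

(** The exponents add up to q + (p - 2) q = (p - 1) q = 1 for q = 1 / (p - 1): [phi p] undoes the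
    power q in the slope. *)
Lemma phi_opp_apow (p x : R) : 2 < p -> phi p (- apow (1 / (p - 1)) x) = - Rabs x.
Proof.
  intros Hp; assert (Hq : 0 < 1 / (p - 1)) by (apply Rdiv_lt_0_compat; lra).
  unfold phi; rewrite Rabs_Ropp; fold (apow (p - 2) (apow (1 / (p - 1)) x)).
  destruct (Req_dec x 0) as [-> | Hx]; [rewrite (apow_at0 (1 / (p - 1))), Rabs_R0; lra |].
  rewrite apow_apow, Ropp_mult_distr_l_reverse, <- apow_plus by (auto; lra).
  replace (1 / (p - 1) + (p - 2) * (1 / (p - 1))) with 1 by (field; lra).
  now rewrite apow_1.
Qed.

Definition truncate (a b x : R) : R := Rmax a (Rmin b x).

Lemma truncate_bounds a b x : a <= b -> a <= truncate a b x <= b.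
Proof. unfold truncate, Rmax, Rmin; repeat destruct Rle_dec; lra. Qed.

Lemma truncate_id a b x : a <= x <= b -> truncate a b x = x.
Proof. unfold truncate, Rmax, Rmin; repeat destruct Rle_dec; lra. Qed.

Lemma truncate_contracts a b x y :
  Rabs (truncate a b x - truncate a b y) <= Rabs (x - y).
Proof.
  unfold truncate, Rmax, Rmin, Rabs; repeat destruct Rle_dec; repeat destruct Rcase_abs; lra.
Qed.

(** Here phi(U') = - t J(t) with J the average of g, and J is differentiable for t > 0 even when g
    is merely continuous. The derivative of - t J is (n - 1) J - g, which is the equation. *)
Lemma ivp_solution_radial n p alpha b (f g U : R -> R) :
  (1 <= n)%nat -> 2 < p -> (forall x, continuous g x) ->
  (forall t, 0 < ball_average n g t) -> 0 < b ->
  (forall r, Ico b r -> U r = radial n (1 / (p - 1)) alpha g r) ->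
  (forall r, Ico b r -> f (U r) = g r) ->
  ivp_solution n p alpha f b U.
Proof.
  intros Hn Hp Hg HJ Hb HU HfU; set (q := 1 / (p - 1)) in *.
  assert (Hq : 0 < q <= 1).
  { split; [apply Rdiv_lt_0_compat; lra | apply Rle_div_l; lra]. }
  assert (H0 : Ico b 0) by (unfold Ico; lra).
  exists (fun r => - slope n q g r).
  assert (Hphi : forall t, 0 < t -> phi p (- slope n q g t) = - (t * ball_average n g t)).
  { intros t Ht; unfold slope; rewrite <- apow_mult by lra.
    pose proof (HJ t); unfold q; rewrite phi_opp_apow, Rabs_pos_eq by (lra || nra); easy. }
  assert (Hd : forall r, 0 < r ->
    is_derive (fun t => phi p (- slope n q g t)) r ((INR n - 1) * ball_average n g r - g r)).
  { intros r Hr; apply is_derive_ext_loc with (fun t => - (t * ball_average n g t)).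
    { apply (locally_interval _ r 0 p_infty); simpl; auto; intros t Ht _; symmetry; auto. }
    pose proof (is_derive_mult (fun t => t) (ball_average n g) r _ _
      (is_derive_id (K := R_AbsRing) r) (is_derive_ball_average n g r Hn Hg Hr) Rmult_comm) as H.
    apply (is_derive_opp (fun t => t * ball_average n g t)) in H.
    replace ((INR n - 1) * ball_average n g r - g r) with
      (opp (plus (mult one (ball_average n g r))
        (mult r ((g r - INR n * ball_average n g r) / r)))); [exact H |].
    unfold opp, plus, mult, one; simpl; field; lra. }
  split; [| split; [| split; [| split]]].
  - apply (derive_on_Ico_of_is_derive b U (radial n q alpha g)); auto.
    intros; now apply is_derive_radial.
  - apply continuous_on_forall; intros r _.
    apply (continuous_opp (slope n q g)), continuous_slope; [lra | exact Hg].
  - intros r Hr; split; [eexists; apply Hd; lra | split].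
    + apply continuous_ext_loc with (fun r => (INR n - 1) * ball_average n g r - g r).
      * apply (locally_interval _ r 0 p_infty); simpl; try lra; auto.
        intros t Ht _; symmetry; apply is_derive_unique, Hd, Ht.
      * apply (continuous_minus (fun r => (INR n - 1) * ball_average n g r) g); [| apply Hg].
        apply (continuous_scal_r (INR n - 1) (ball_average n g)).
        now apply continuous_ball_average.
    + replace (Derive _ r) with ((INR n - 1) * ball_average n g r - g r)
        by (symmetry; apply is_derive_unique, Hd; lra).
      rewrite Hphi, HfU by (unfold Ico; lra); field; lra.
  - rewrite HU by easy; unfold radial.
    rewrite (RInt_point (V := R_CompleteNormedModule)); unfold zero; simpl; ring.
  - unfold slope; rewrite apow_at0; lra.
Qed.

(** * Choice of the radius, then existence, regularity and uniqueness *)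

Theorem theorem2p1 (n : nat) (p alpha : R) (f : R -> R)
    (hn : (1 <= n)%nat) (hp : 2 < p) (halpha : 0 < alpha)
    (hf : lipschitz f) (hfalpha : 0 < f alpha) :
  exists eps0 : R, 0 < eps0 /\
  forall eps : R, 0 < eps < eps0 ->
  exists u : R -> R,
    let b := rpow eps (2 * (p - 1) / p) in
    let U := fun r : R => u (rpow r (p / (2 * (p - 1)))) in
    of_class_C_Ico 2 eps u /\
    (forall z : R, 0 < z < eps -> Derive u z < 0) /\
    ivp_solution n p alpha f b U /\
    integral_equation n p alpha f b U /\
    (forall V : R -> R,
       continuous_on (Ico b) V -> integral_equation n p alpha f b V ->
       forall r : R, Ico b r -> V r = U r) /\
    (forall k : nat, (1 <= k)%nat -> of_class_C k f ->
       of_class_C_Ico (k + 2) eps u).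
Proof.
  destruct hf as [L hL].
  assert (L0 : 0 <= L).
  { pose proof (hL 1 0) as H; rewrite Rminus_0_r, Rabs_R1 in H.
    pose proof (Rabs_pos (f 1 - f 0)); lra. }
  assert (fcont : forall x, continuous f x) by now apply (lipschitz_continuous L).
  set (q := 1 / (p - 1)); set (beta := 2 * (p - 1) / p).
  assert (Hq : 0 < q <= 1).
  { split; [apply Rdiv_lt_0_compat; lra | apply Rle_div_l; lra]. }
  assert (Hbeta : 1 < beta) by (apply Rlt_div_r; lra).
  assert (Hbq : beta * (1 + q) = 2) by (unfold beta, q; field; lra).
  (* Truncation to [m, M] with m > 0 keeps the averages away from 0, where x^q, with q < 1, fails to
     be Lipschitz. *)
  set (m := f alpha / 2); set (M := 2 * f alpha).
  set (h := fun x => truncate m M (f x)).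
  assert (Hh : forall x, m <= h x <= M) by (intro; apply truncate_bounds; unfold m, M; lra).
  assert (hh : forall x y, Rabs (h x - h y) <= L * Rabs (x - y)).
  { intros x y; eapply Rle_trans; [apply truncate_contracts | apply hL]. }
  assert (Hm : 0 < m) by (unfold m; lra).
  assert (Hn0 : 0 < INR n) by (apply lt_0_INR; lia).
  destruct (apow_lipschitz q (m / INR n) Hq) as [K [K0 HK]]; [now apply Rdiv_lt_0_compat |].
  assert (HKL : 0 <= K * L) by now apply Rmult_le_pos.
  (* The bound [delta * c <= 1] will say that f changes by at most f(alpha) / 2 on the range where
     solutions stay. *)
  set (c := 4 * ((1 + f alpha) * L) / f alpha).
  assert (Hc : 0 <= c).
  { unfold c; apply Rle_mult_inv_pos; auto; assert (0 <= (1 + f alpha) * L); nra. }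
  (* Each summand of [D] stands for one constraint on delta = 1 / D: delta <= 1, the contraction,
     the absorption in the a priori bound, and the invisibility of the truncation. *)
  set (D := 1 + 2 * (K * L) + 2 * L + c).
  set (delta := / D).
  assert (HD : 1 <= D) by (unfold D; lra).
  assert (Hdelta : 0 < delta <= 1).
  { unfold delta; split; [apply Rinv_0_lt_compat; lra |].
    rewrite <- Rinv_1; apply Rinv_le_contravar; lra. }
  assert (HdD : delta * D = 1) by (unfold delta; apply Rinv_l; lra).
  assert (Hd1 : delta * (K * L) <= / 2) by (unfold D in HdD; nra).
  assert (Hd2 : delta * L <= / 2) by (unfold D in HdD; nra).
  assert (Hd3 : L * (2 * delta * (1 + f alpha)) <= f alpha / 2).
  { assert (H : delta * c <= 1) by (unfold D in HdD; nra).
    replace (L * (2 * delta * (1 + f alpha))) with (delta * c * (f alpha / 2))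
      by (unfold c; field; lra).
    nra. }
  assert (Htrunc : forall x, 0 <= alpha - x <= 2 * delta * (1 + f alpha) -> h x = f x).
  { intros x Hx; apply truncate_id.
    pose proof (hL x alpha) as H; rewrite (Rabs_left1 (x - alpha)) in H by lra.
    assert (L * - (x - alpha) <= L * (2 * delta * (1 + f alpha)))
      by (apply Rmult_le_compat_l; lra).
    apply (Rle_trans _ _ _ H), (fun H1 => Rle_trans _ _ _ H1 Hd3), Rabs_le_between' in H0.
    unfold m, M; lra. }
  destruct (picard_fixed_point n q alpha m M L K delta h) as [W [HW HWE]]; auto.
  set (g := fun s => h (W s)) in HWE.
  assert (Hg : forall x, continuous g x).
  { apply (continuous_comp_R h W); [now apply (lipschitz_continuous L) | exact HW]. }
  assert (HJ : forall t, 0 < ball_average n g t).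
  { intro t; apply Rlt_le_trans with (m / INR n); [now apply Rdiv_lt_0_compat |].
    now apply (ball_average_bounds n m M L h hn Hm Hh hh W t HW). }
  assert (hfa : h alpha = f alpha) by (apply truncate_id; unfold m, M; lra).
  (* [W] solves the truncated equation, so the a priori bound is applied with [h] in place of [f];
     it then shows that h and f agree along [W]. *)
  assert (HnearW : forall r, 0 <= r <= delta -> 0 <= alpha - W r <= 2 * delta * (1 + f alpha)).
  { intros r Hr.
    assert (H : 0 <= alpha - W r <= 2 * r * (1 + h alpha)).
    { apply (solution_near_start n q alpha L r h W); auto; try lra; try nra.
      - intros x Hx; apply HWE; lra.
      - intros x Hx; left; apply HJ. }
    rewrite hfa in H; split; [lra |].
    apply Rle_trans with (1 := proj2 H), Rmult_le_compat_r; lra. }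
  assert (Hgf : forall r, 0 <= r <= delta -> g r = f (W r)) by (intros; apply Htrunc; auto).
  exists delta; split; [lra |]; intros eps Heps.
  exists (profile n q beta alpha g); intros b U.
  assert (Hapow : forall z, Rabs z < eps -> 0 <= apow beta z <= delta).
  { intros z Hz; split; [apply apow_ge0 |]; rewrite <- apow_abs.
    destruct (Rabs_pos z) as [Hz0 | <-]; [| rewrite apow_at0; lra].
    apply Rle_trans with (Rabs z); [apply apow_le_base |]; lra. }
  assert (Hb : 0 < b < delta).
  { unfold b; fold beta; rewrite <- apow_nonneg by lra.
    split; [apply apow_gt0; lra |].
    apply Rle_lt_trans with eps; [apply apow_le_base |]; lra. }
  assert (HU : forall r, 0 <= r -> U r = radial n q alpha g r).
  { intros r Hr; unfold U, profile; rewrite <- apow_nonneg by easy.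
    assert (0 < p / (2 * (p - 1))) by (apply Rdiv_lt_0_compat; lra).
    rewrite apow_apow by lra.
    replace (beta * (p / (2 * (p - 1)))) with 1 by (unfold beta; field; lra).
    now rewrite apow_1, Rabs_pos_eq. }
  assert (HUW : forall r, 0 <= r <= delta -> U r = W r).
  { intros r Hr; rewrite HU by lra; symmetry; now apply HWE. }
  assert (Hcomp : forall z, Rabs z < eps -> g (apow beta z) = f (profile n q beta alpha g z)).
  { intros z Hz; rewrite Hgf by auto; f_equal; apply HWE; auto. }
  assert (HfWc : forall x, continuous (fun s => f (W s)) x) by now apply continuous_comp_R.
  assert (HIcoD : forall x, Ico eps x -> Rabs x < eps).
  { intros x [H1 H2]; now rewrite Rabs_pos_eq. }
  split; [| split; [| split; [| split; [| split]]]].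
  - apply of_class_C_Ico_of_smooth_on with (fun z => Rabs z < eps); auto.
    apply smooth_on_profile_SS; auto.
    split; [intros; now apply continuous_profile'' | easy].
  - intros z Hz.
    rewrite (is_derive_unique _ _ _ (is_derive_profile n q beta alpha g Hq Hbeta Hbq Hg z)).
    unfold profile'.
    assert (0 < apow q (mean n beta g z)).
    { apply apow_gt0; pose proof (mean_pos n beta g HJ z); lra. }
    assert (0 < z * (beta * apow q (mean n beta g z)))
      by (apply Rmult_lt_0_compat; [| apply Rmult_lt_0_compat]; lra).
    lra.
  - apply (ivp_solution_radial n p alpha b f g U); auto; try lra.
    + intros r Hr; apply HU, Hr.
    + intros r [Hr1 Hr2]; rewrite HUW by lra; symmetry; apply Hgf; lra.
  - assert (HI : forall t, 0 <= t < b -> inner_integral n f U t = inner_integral n f W t).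
    { intros t Ht; apply inner_integral_ext; [lra |]; intros s Hs; apply HUW; lra. }
    assert (HI0 : forall t, 0 <= t < b -> 0 <= inner_integral n f W t).
    { intros t Ht; rewrite inner_integral_ball_average by auto.
      apply Rmult_le_pos; [apply pow_le; lra |].
      rewrite <- (ball_average_ext n g _ delta) by (lra || auto); left; apply HJ. }
    split; intros r Hr; [rewrite HI by easy; now apply HI0 |].
    unfold Ico in Hr; rewrite HU by lra; unfold radial; f_equal.
    rewrite (RInt_slope_ext n q g (fun s => f (W s))) by (intros; try apply Hgf; lra).
    unfold q; rewrite <- RInt_integrand_slope; auto; try lra.
    + apply RInt_ext; intros t; rewrite Rmin_left, Rmax_right by lra; intros Ht.
      now rewrite HI by lra.
    + intros; apply HI0; lra.
  - intros V HV HVE r Hr.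
    (* At r = 0 both functions equal alpha. For r > 0, [V] is frozen beyond this r, which lies
       strictly below b, so that [V'] is continuous on R and solves the equation on [0, r]. *)
    destruct (proj1 Hr) as [Hr0 | <-].
    2:{ destruct HVE as [_ HVE]; rewrite HVE, HUW, HWE by (unfold Ico in *; lra).
        now rewrite !(RInt_point (V := R_CompleteNormedModule)). }
    assert (Hrb : r < b) by apply Hr; assert (Hr1 : 0 < r <= 1) by lra.
    pose proof (integral_equation_clamp n p alpha b r f V hn hp fcont hfalpha Hr1 Hrb HV HVE)
      as HE.
    pose proof (continuous_clamp_comp b r V Hr1 Hrb HV) as HVc.
    set (V' := fun s => V (clamp r s)) in *.
    (* [V'] solves the equation for f; staying near alpha makes it a solution of the truncated
       equation too, to which the contraction applies. *)
    assert (Hnear : forall x, 0 <= x <= r -> 0 <= alpha - V' x <= 2 * delta * (1 + f alpha)).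
    { intros x Hx.
      assert (H : 0 <= alpha - V' x <= 2 * x * (1 + f alpha)).
      { apply (solution_near_start n q alpha L x f V'); auto; try lra; try nra;
          intros y Hy; apply HE; lra. }
      split; [lra |]; apply Rle_trans with (1 := proj2 H), Rmult_le_compat_r; lra. }
    replace (V r) with (V' r) by (unfold V'; now rewrite clamp_id by lra).
    rewrite HUW by lra.
    (* Both solutions lie in [alpha - B, alpha] on [0, r], so B bounds their difference. *)
    apply (picard_unique n q alpha m M L K delta h) with (B := 2 * delta * (1 + f alpha)); auto; try lra.
    + intros x Hx; transitivity (alpha - RInt (slope n q (fun s => f (V' s))) 0 x);
        [now apply HE | f_equal].
      apply RInt_slope_ext; [lra |]; intros y Hy; symmetry; apply Htrunc, Hnear; lra.
    + intros x Hx; apply HWE; lra.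
    + intros x Hx; pose proof (Hnear x Hx); pose proof (HnearW x ltac:(lra)).
      apply Rabs_le; lra.
  - intros k Hk Hf; replace (k + 2)%nat with (S (S k)) by lia.
    apply of_class_C_Ico_of_smooth_on with (fun z => Rabs z < eps); auto.
    now apply smooth_on_profile with (f := f).
Qed.
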